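(* Let $n\ge6$ and $\lambda=(2^2,1^{n-4})$. As abelian groups, we have $$\begin{array}{rcl}S^{\lambda,*}/S^\lambda&\cong&\left(\mathbb{Z}/2^{\{n\equiv_2 1\}}\cdot2(n-4)!\,\mathbb{Z}\right)^1\oplus\left(\mathbb{Z}/(n-1)\cdot2(n-4)!\,\mathbb{Z}\right)^{n-3}\\&&\oplus\left(\mathbb{Z}/2^{\{n\equiv_20\}}(n-1)\cdot2(n-4)!\,\mathbb{Z}\right)^1\oplus\left(\mathbb{Z}/(n-2)(n-1)\cdot2(n-4)!\,\mathbb{Z}\right)^{(n^2-5n+2)/2}\;.\end{array}$$ Moreover, bases $x$ and $y$ of $S^\lambda$ trigonalizing the Gram matrix (in the sense defined in the context) are given as follows. Let $$\begin{array}{rcll}y_i&:=&\langle n-i\,|\,n\rangle&\text{for }i\in[1,n-2],\\ y_{(n-2)+i}&:=&\langle n-1-i\,|\,n-1\rangle&\text{for }i\in[1,n-3],\\ y_{(2n-5)+i}&:=&\langle b_i\,|\,c_i\rangle&\text{for }i\in[1,\binom{n-3}{2}-1],\end{array}$$ where $(b_i,c_i)$ runs over the pairs with $b_i,c_i\in[2,n-2]$, $b_i<c_i$, $(b_i,c_i)\ne(2,3)$, ordered such that $i<j$ implies that $c_i>c_j$, or that $c_i=c_j$ and $b_i>b_j$. Let $$\begin{array}{rcll}x_i&:=&(-1)^{n-i}\langle1\,|\,n-1\rangle+\langle n-i\,|\,n-1\rangle&\text{for }i\in[2,n-2],\\ x_{(n-2)+i}&:=&\langle n-1-i\,|\,n-1\rangle\rho^+&\text{for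 }i\in[2,n-3],\\ x_{(2n-5)+i}&:=&\langle b_i\,|\,c_i\rangle\rho^+&\text{for }i\in[1,\binom{n-3}{2}-1].\end{array}$$ Moreover, let $$x_1:=\begin{cases}\langle3\,|\,4\rangle&\text{if }n\text{ is odd},\\ \langle3\,|\,n\rangle+\frac{n-2}{2}\langle3\,|\,4\rangle&\text{if }n\text{ is even},\end{cases}$$ and $$x_{(n-2)+1}:=\begin{cases}\frac{n-3}{2}\langle n-2\,|\,n-1\rangle\rho^+-\frac{n-1}{2}\Big(\langle3\,|\,n\rangle+(-1)^n\langle n-1\,|\,n\rangle-(n-3)\langle3\,|\,n-1\rangle\Big)&\text{if }n\text{ is odd},\\ \langle n-2\,|\,n-1\rangle\rho^++\Big(\langle3\,|\,n\rangle+(-1)^n\langle n-1\,|\,n\rangle-(n-3)\langle3\,|\,n-1\rangle\Big)&\text{if }n\text{ is even}.\end{cases}$$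
   Context: Notation: $[a,b]$ is the integral interval; for an assertion $A$, $\{A\}=1$ if $A$ is true and $0$ otherwise; $a\equiv_m b$ means $a-b\in m\mathbb{Z}$. Specht modules: a $\lambda$-tableau $[a]$ is a bijective filling of the diagram of $\lambda$ with $1,\dots,n$; a $\lambda$-tabloid $\{a\}$ is a tableau with unordered rows. $M^\lambda$ is the free $\mathbb{Z}$-module on the $\lambda$-tabloids, with $\mathcal{S}_n$ acting (on the right) on entries, and with the bilinear form $(-,=)$ for which the tabloids are orthonormal. With $C_a$ the column stabilizer of $[a]$, the polytabloid is $\langle a\rangle=\sum_{\sigma\in C_a}\varepsilon_\sigma\{a\}\sigma$ ($\varepsilon_\sigma$ the sign). $S^\lambda\subseteq M^\lambda$ is the $\mathbb{Z}$-span of the polytabloids, with the restricted form $(-,=)$. $S^{\lambda,*}/S^\lambda$ denotes the cokernel of $S^\lambda\to\mathrm{Hom}_{\mathbb{Z}}(S^\lambda,\mathbb{Z})$, $\xi\mapsto(\xi,-)$. For $\lambda=(2^2,1^{n-4})$ and $a,b\in[1,n]$, $a\ne b$, $\langle a\,|\,b\rangle$ denotes the $\lambda$-polytabloid belonging to the tableau whose second column is $(a,b)$ (read from top to bottom) and whose first column consists of the remaining entries, increasingly ordered from top to bottom. $\langle a\,|\,b\rangle\rho^+$ denotes $\sum_{\sigma}\langle a\,|\,b\rangle\sigma$, where $\sigma$ runs over the row stabilizer in $\mathcal{S}_n$ of that tableau. Trigonalizing: let $m=\mathrm{rk}_{\mathbb{Z}}S^\lambda$ and $G$ be the Gram matrix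 of $(-,=)$ with respect to a $\mathbb{Z}$-basis of $S^\lambda$. Tuples $x=(x_1,\dots,x_m)$, $y=(y_1,\dots,y_m)$ in $S^\lambda$ are said to trigonalize the Gram matrix if: (i) $(x_i,y_i)\ne0$ for all $i$; (ii) $(x_i,y_j)=0$ for $i>j$; (iii) $(x_i,y_i)$ divides $(x_i,y_j)$ for $i<j$; (iv) $(x_i,y_i)$ divides $(x_{i+1},y_{i+1})$ for $i\in[1,m-1]$; (v) $\prod_i(x_i,y_i)=\pm\det G$. *)

(* Defs.v *)
From HB Require Import structures.
From mathcomp Require Import all_boot all_order all_algebra all_fingroup.
From mathcomp Require Import boolp functions.
Set Implicit Arguments.
Unset Strict Implicit.
Unset Printing Implicit Defensive.
Import GRing.Theory.
Local Open Scope ring_scope.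

Section Tableaux.
Variables (n : nat) (lam : seq nat).

(** Here [lam] is meant to be a partition of [n]; rows and columns are numbered
    from 0, and the entry [k] in [1, n] is the ordinal of value [k - 1]. Since a
    partition is weakly decreasing, [head 0 lam] is its number of columns. *)

Definition cell : finType :=
  {c : 'I_(size lam) * 'I_(head 0%N lam) | (c.2 < nth 0%N lam c.1)%N}.

Definition filling : finType := {ffun cell -> 'I_n}.

Implicit Types (t : filling) (s : 'S_n).

Definition is_tableau t : bool :=
  injectiveb t && [forall k, k \in codom t].

Definition row_set t (i : 'I_(size lam)) : {set 'I_n} :=
  [set t c | c : cell & (val c).1 == i].

Definition col_set t (j : 'I_(head 0%N lam)) : {set 'I_n} :=
  [set t c | c : cell & (val c).2 == j].

Definition row_stab t : {set 'S_n} :=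
  [set s : 'S_n | [forall i, s @: row_set t i == row_set t i]].

Definition col_stab t : {set 'S_n} :=
  [set s : 'S_n | [forall j, s @: col_set t j == col_set t j]].

(** The product [s * s'] of [{perm T}] is "first s, then s'", so the operations
    below are right actions. *)
Definition tact t s : filling := [ffun c => s (t c)].

Definition rowfam : finType := {ffun 'I_(size lam) -> {set 'I_n}}.

Definition rows t : rowfam := [ffun i => row_set t i].

Definition rowfam_act (r : rowfam) s : rowfam := [ffun i => s @: (r i : {set _})].

Definition tabloid : finType :=
  {r : rowfam | [exists t : filling, is_tableau t && (r == rows t)]}.

(** The module M^lam. *)
Definition permmod : Type := {ffun tabloid -> int}.
HB.instance Definition _ := GRing.Zmodule.on permmod.

Implicit Types u v : permmod.

(** The basis vector of the tabloid [r] (and 0 if [r] is not a tabloid). *)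
Definition tvec (r : rowfam) : permmod :=
  [ffun T : tabloid => Posz (val T == r)].

Definition pact v s : permmod :=
  \sum_(T : tabloid) tvec (rowfam_act (val T) s) *~ v T.

Definition spform u v : int := \sum_(T : tabloid) u T * v T.

Definition polytabloid t : permmod :=
  \sum_(s in col_stab t) tvec (rows (tact t s)) *~ (-1) ^+ s.

Definition in_specht : {pred permmod} := fun v =>
  `[< exists z : filling -> int,
        v = \sum_(t : filling | is_tableau t) polytabloid t *~ z t >].

Lemma in_specht_closed : zmod_closed in_specht.
Proof.
split=> [|u v /asboolP[a ->] /asboolP[b ->]]; apply/asboolP.
  by exists (fun=> 0); rewrite big1.
exists (fun t => a t - b t); rewrite -sumrB.
by apply: eq_bigr => t _; rewrite mulrzBr.
Qed.
HB.instance Definition _ :=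
  GRing.isZmodClosed.Build permmod in_specht in_specht_closed.

Definition specht : Type := {v : permmod | v \in in_specht}.
HB.instance Definition _ := SubChoice.on specht.
HB.instance Definition _ := [SubChoice_isSubZmodule of specht by <:].

Lemma formDl u v w : spform (u + v) w = spform u w + spform v w.
Proof.
by rewrite -big_split; apply: eq_bigr => T _; rewrite ffunE mulrDl.
Qed.

Lemma formNl u w : spform (- u) w = - spform u w.
Proof.
by rewrite -sumrN; apply: eq_bigr => T _; rewrite ffunE mulNr.
Qed.

End Tableaux.

Section IntegralDual.
Variable A : zmodType.

Definition is_hom : {pred (A -> int)} := fun f =>
  `[< forall a b, f (a + b) = f a + f b >].

Lemma is_hom_closed : zmod_closed is_hom.
Proof.
split=> [|f g /asboolP fD /asboolP gD]; apply/asboolP => a b.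
  by rewrite addr0.
have E (x : A) : (f - g) x = f x - g x by [].
by rewrite !E fD gD opprD addrACA.
Qed.
HB.instance Definition _ := GRing.isZmodClosed.Build (A -> int) is_hom
  is_hom_closed.

(** Hom_Z(A, Z), with pointwise addition. *)
Definition Zdual : Type := {f : A -> int | f \in is_hom}.
HB.instance Definition _ := SubChoice.on Zdual.
HB.instance Definition _ := [SubChoice_isSubZmodule of Zdual by <:].

End IntegralDual.

Section DualQuotient.
Variables (n : nat) (lam : seq nat).

(** The image of S^lam -> Hom_Z(S^lam, Z), xi |-> (xi, -). *)
Definition in_form_image : {pred Zdual (specht n lam)} := fun f =>
  `[< exists xi : specht n lam,
        forall eta : specht n lam, val f eta = spform (val xi) (val eta) >].

Lemma in_form_image_closed : zmod_closed in_form_image.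
Proof.
split=> [|f g /asboolP[a fa] /asboolP[b gb]]; apply/asboolP.
  exists 0 => eta; rewrite raddf0 raddf0 /spform big1 // => T _.
  by rewrite ffunE mul0r.
exists (a - b) => eta; rewrite !raddfB formDl formNl -fa -gb.
by [].
Qed.
HB.instance Definition _ := GRing.isZmodClosed.Build (Zdual (specht n lam))
  in_form_image in_form_image_closed.

Definition dual_quotient : zmodType := Quotient.quot (in_form_image : zmodClosed _).

End DualQuotient.

Definition isomorphic (A B : zmodType) : Prop :=
  exists f : {additive A -> B}, bijective f.

(** [(Z/dZ)^k]; ['Z_d] is the ring Z/dZ only for [d > 1]. *)
Definition Zmod_pow (d k : nat) : zmodType := {ffun 'I_k -> 'Z_d}.

Section Bases.
Variables (n : nat) (lam : seq nat) (m : nat).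
Implicit Types x y b : 'I_m -> permmod n lam.

Definition Zbasis_specht x : Prop :=
  (forall i, x i \in @in_specht n lam) /\
  (forall v, v \in @in_specht n lam ->
     exists! z : {ffun 'I_m -> int}, v = \sum_i x i *~ z i).

Definition gram x y : 'M[int]_m := \matrix_(i, j) spform (x i) (y j).

Record trigonalize x y : Prop := Trigonalize {
  trig_rank : exists b, Zbasis_specht b;
  trig_specht : forall i, x i \in @in_specht n lam /\ y i \in @in_specht n lam;
  trig_diag : forall i, spform (x i) (y i) != 0;
  trig_lower : forall i j : 'I_m, (j < i)%N -> spform (x i) (y j) = 0;
  trig_upper : forall i j : 'I_m, (i < j)%N ->
    (spform (x i) (y i) %| spform (x i) (y j))%Z;
  trig_chain : forall i j : 'I_m, j = i.+1 :> nat ->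
    (spform (x i) (y i) %| spform (x j) (y j))%Z;
  trig_det : forall b, Zbasis_specht b ->
    \prod_i spform (x i) (y i) = \det (gram b b) \/
    \prod_i spform (x i) (y i) = - \det (gram b b) }.

End Bases.

Section TwoColumn.
Variable n : nat.

(** The partition (2^2, 1^(n-4)); used for [n >= 4] only. *)
Definition lam22 : seq nat := [:: 2, 2 & nseq (n - 4) 1]%N.

(** [nth] gets the default [a] only for lack of another one: for [a != b] the
    list below has [n - 2] elements, one for each row. *)
Definition ab_tableau (a b : 'I_n) : filling n lam22 :=
  [ffun c : cell lam22 =>
     if (val c).2 == 0%N :> nat
     then nth a [seq k <- enum 'I_n | k \notin [:: a; b]] (val c).1
     else if (val c).1 == 0%N :> nat then a else b].

(** The tableau of <a|b> for integers [a], [b] of [1, n]. *)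
Definition abtab (a b : nat) : option (filling n lam22) :=
  if (insub a.-1, insub b.-1) is (Some a', Some b')
  then Some (ab_tableau a' b') else None.

(** <a|b> and <a|b> rho^+; the value 0 is used only outside of [1, n]. *)
Definition br (a b : nat) : permmod n lam22 :=
  if abtab a b is Some t then polytabloid t else 0.

Definition br_rho (a b : nat) : permmod n lam22 :=
  if abtab a b is Some t then \sum_(s in row_stab t) pact (br a b) s else 0.

Definition bc_pairs : seq (nat * nat) :=
  [seq p <- [seq (b, c) | c <- rev (iota 2 (n - 3)), b <- rev (iota 2 (n - 3))]
     | (p.1 < p.2)%N && (p != (2, 3)%N)].

Definition bi (i : nat) : nat := (nth (0, 0)%N bc_pairs i.-1).1.
Definition ci (i : nat) : nat := (nth (0, 0)%N bc_pairs i.-1).2.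

Definition spart : permmod n lam22 :=
  br 3 n + br (n - 1) n *~ (-1) ^+ n - br 3 (n - 1) *+ (n - 3).

(** The elements x_i and y_i, for i = 1, ..., n(n-3)/2. *)

Definition yvec (i : nat) : permmod n lam22 :=
  if (i <= n - 2)%N then br (n - i) n
  else if (i <= 2 * n - 5)%N then let j := (i - (n - 2))%N in
    br (n - 1 - j) (n - 1)
  else let j := (i - (2 * n - 5))%N in br (bi j) (ci j).

Definition xvec (i : nat) : permmod n lam22 :=
  if i == 1%N then
    if odd n then br 3 4 else br 3 n + br 3 4 *+ (n - 2)./2
  else if (i <= n - 2)%N then
    br 1 (n - 1) *~ (-1) ^+ (n - i) + br (n - i) (n - 1)
  else if i == (n - 2 + 1)%N then
    if odd n then br_rho (n - 2) (n - 1) *+ (n - 3)./2 - spart *+ (n - 1)./2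
    else br_rho (n - 2) (n - 1) + spart
  else if (i <= 2 * n - 5)%N then let j := (i - (n - 2))%N in
    br_rho (n - 1 - j) (n - 1)
  else let j := (i - (2 * n - 5))%N in br_rho (bi j) (ci j).

Definition nvec : nat := ((n - 2) + (n - 3) + ('C(n - 3, 2) - 1))%N.

End TwoColumn.

(* Main.v *)
Require Import Defs.
From HB Require Import structures.
From mathcomp Require Import all_boot all_order all_algebra all_fingroup.
From mathcomp Require Import boolp functions.
From mathcomp Require Import zify ring.
Set Implicit Arguments.
Unset Strict Implicit.
Unset Printing Implicit Defensive.
Import Order.TTheory GRing.Theory Num.Theory.
Local Open Scope ring_scope.

(* Up to sign, the polytabloid of a tableau of shape (2^2, 1^(n-4)) depends only
   on the two entries of its second column, so S^lambda is spanned by vectors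
   indexed by the edges of the complete graph K_n. On these the form is
   2(n-4)! times (n-1)(n-2) I - (n-1) B^T B + 2 J, where B is the incidence
   matrix and J the all-one matrix. Vectors of norm zero vanish, whence the
   relations: the sum over each star, and the sum over all edges, are zero.
   The y_j generate by these relations. Modulo the x_i the edges collapse to
   three classes subject to three relations of determinant 1 or -1, so the x_i
   generate as well. In the given order the matrix of all (x_i, y_j) is a diagonal
   matrix times an upper unitriangular one, and the diagonal gives the cokernel. *)

(** * Tabloids and the bilinear form *)

(** The form on edges is a count of permutations. Up to sign, a polytabloid is the alternating sum
    of the tabloids {t0}s over all s that carry the second column of a fixed tableau t0 to a given
    pair. Two such tabloids agree iff they differ by the row stabilizer of t0, a Klein four-group,
    whose elements move the second column to pairs that meet it in 2, 1, 1 and 0 points. The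
    obstacle is integrality. Generators with a nonsingular matrix of mutual products are bases, and
    base change has determinant 1 or -1, which gives condition (v) for every basis at once; so both
    families must generate over Z and not only over Q. This dictates x_1 and x_{(n-2)+1}. With the
    alternating 4-cycle of (n-2, n-1) alone in the latter place, the diagonal entry would contain
    (n-1)(n-2) and the family would span a proper sublattice. The correction by a vector orthogonal
    to y_1, ..., y_{n-2} lowers n-2 to 1 or 2, according to the parity of n. *)

Section Tableaux.
Variables (n : nat) (lam : seq nat).
Local Notation filling := (filling n lam).
Local Notation cell := (cell lam).
Implicit Types (t : filling) (s : 'S_n) (c : cell).

Lemma tableau_inj t : is_tableau t -> injective t.
Proof. by case/andP => /injectiveP. Qed.

Lemma tableau_onto t k : is_tableau t -> exists c, k = t c.
Proof.
by case/andP => _ /forallP/(_ k)/codomP[c ->]; exists c.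
Qed.

Lemma tact1 t : tact t 1 = t.
Proof. by apply/ffunP => c; rewrite ffunE perm1. Qed.

Lemma tactM t s s' : tact t (s * s')%g = tact (tact t s) s'.
Proof. by apply/ffunP => c; rewrite !ffunE permM. Qed.

Lemma tact_tableau t s : is_tableau t -> is_tableau (tact t s).
Proof.
move=> tP; apply/andP; split.
  by apply/injectiveP => c c'; rewrite !ffunE => /perm_inj/(tableau_inj tP).
apply/forallP => k; have [c cE] := tableau_onto (s^-1%g k) tP.
by apply/codomP; exists c; rewrite ffunE -cE permKV.
Qed.

Lemma tact_trans t t' : is_tableau t -> is_tableau t' ->
  exists s, t' = tact t s.
Proof.
move=> tP t'P; have t_inj := tableau_inj tP.
have onto k : k \in codom t by case/andP: tP => _ /forallP.
pose f k := t' (iinv (onto k)).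
have f_inj : injective f.
  move=> k l /(tableau_inj t'P) kl.
  by rewrite -(f_iinv (onto k)) kl f_iinv.
exists (perm f_inj); apply/ffunP => c; rewrite ffunE permE /f.
by congr (t' _); apply: t_inj; rewrite f_iinv.
Qed.

Lemma row_set_tact t s i : row_set (tact t s) i = s @: row_set t i.
Proof.
rewrite /row_set -imset_comp; apply: eq_imset => c.
by rewrite /= ffunE.
Qed.

Lemma imset_permM (A : {set 'I_n}) s s' : (s * s')%g @: A = s' @: (s @: A).
Proof. by rewrite -imset_comp; apply: eq_imset => k; rewrite permM. Qed.

Lemma imset_perm1 (A : {set 'I_n}) : (1%g : 'S_n) @: A = A.
Proof. by rewrite -[RHS]imset_id; apply: eq_imset => k; rewrite perm1. Qed.

Lemma imset_perm_inj s : injective (fun A : {set 'I_n} => s @: A).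
Proof. by apply: imset_inj; exact: perm_inj. Qed.

Lemma rows_tact t s : rows (tact t s) = rowfam_act (rows t) s.
Proof. by apply/ffunP => i; rewrite !ffunE row_set_tact. Qed.

(** Turns products of tabloids into a count over the row stabilizer of one fixed tableau. As
    permutations are composed from left to right, the stabilizer element acts before [s]. *)
Lemma rows_tact_eq t s s' :
  (rows (tact t s) == rows (tact t s')) = ((s' * s^-1)%g \in row_stab t).
Proof.
rewrite inE !rows_tact; apply/eqP/forallP => [/ffunP E i|E].
  have:= E i; rewrite !ffunE => Ei; apply/eqP.
  by rewrite imset_permM -Ei -imset_permM mulgV imset_perm1.
apply/ffunP => i; rewrite !ffunE; apply: (@imset_perm_inj s^-1).
by rewrite /= -!imset_permM mulgV imset_perm1 (eqP (E i)).
Qed.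

Lemma tvec_rows t t' : is_tableau t' ->
  spform (tvec (rows t)) (tvec (rows t')) = (rows t == rows t')%:R.
Proof.
move=> tP; rewrite /spform.
have hP : [exists u : filling, is_tableau u && (rows t' == rows u)].
  by apply/existsP; exists t'; rewrite tP eqxx.
rewrite (bigD1 (Sub (rows t') hP : tabloid n lam)) //= !ffunE SubK eqxx mulr1.
rewrite big1 ?addr0 1?eq_sym ?natz // => T.
by rewrite -val_eqE SubK => /negPf nT; rewrite !ffunE nT mulr0.
Qed.

Lemma spformC (u v : permmod n lam) : spform u v = spform v u.
Proof. by apply: eq_bigr => T _; rewrite mulrC. Qed.

Lemma spform0l (v : permmod n lam) : spform 0 v = 0.
Proof. by rewrite /spform big1 // => T _; rewrite ffunE mul0r. Qed.

Lemma spform_suml (I : Type) (r : seq I) (P : pred I)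
    (F : I -> permmod n lam) v :
  spform (\sum_(i <- r | P i) F i) v = \sum_(i <- r | P i) spform (F i) v.
Proof.
apply: (big_morph (fun u => spform u v)) => [u w|]; first exact: Defs.formDl.
exact: spform0l.
Qed.

Lemma spformDr (u v w : permmod n lam) :
  spform u (v + w) = spform u v + spform u w.
Proof. by rewrite !(spformC u) Defs.formDl. Qed.

Lemma spform_sumr (I : Type) (r : seq I) (P : pred I)
    (F : I -> permmod n lam) v :
  spform v (\sum_(i <- r | P i) F i) = \sum_(i <- r | P i) spform v (F i).
Proof.
by rewrite spformC spform_suml; apply: eq_bigr => i _; rewrite spformC.
Qed.

Lemma spformZl (u v : permmod n lam) (z : int) :
  spform (u *~ z) v = z * spform u v.
Proof.
rewrite /spform mulr_sumr; apply: eq_bigr => T _; rewrite mulrA; congr (_ * _).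
have -> (w : permmod n lam) (y : int) : (w *~ y) T = w T *~ y.
  have N k : (w *+ k) T = w T *+ k.
    by elim: k => [|k IH]; rewrite ?mulr0n ?ffunE // !mulrS ffunE IH.
  by case: y => k; rewrite ?NegzE ?mulrNz -?pmulrn ?ffunE N.
by rewrite mulrzz mulrC.
Qed.

Lemma spformZr (u v : permmod n lam) (z : int) :
  spform u (v *~ z) = z * spform u v.
Proof. by rewrite spformC spformZl spformC. Qed.

(** A norm is a sum of integer squares. The star relations and the total relation both rest on
    this. *)
Lemma spform_eq0 (u : permmod n lam) : spform u u = 0 -> u = 0.
Proof.
move/eqP; rewrite psumr_eq0 => [|T _]; last by rewrite -expr2 sqr_ge0.
move=> /allP u0; apply/ffunP => T; rewrite ffunE; apply/eqP.
by have:= u0 T (mem_index_enum _); rewrite /= mulf_eq0 orbb.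
Qed.

Lemma pactD u v s : pact (u + v : permmod n lam) s = pact u s + pact v s.
Proof.
by rewrite -big_split; apply: eq_bigr => T _; rewrite ffunE mulrzDr.
Qed.

Lemma pact0 s : pact (0 : permmod n lam) s = 0.
Proof. by rewrite /pact big1 // => T _; rewrite ffunE mulr0z. Qed.

Lemma pactN u s : pact (- u : permmod n lam) s = - pact u s.
Proof.
by apply/eqP; rewrite -subr_eq0 opprK -pactD addNr pact0.
Qed.

Lemma pact_sum (I : Type) (r : seq I) (P : pred I)
    (F : I -> permmod n lam) s :
  pact (\sum_(i <- r | P i) F i) s = \sum_(i <- r | P i) pact (F i) s.
Proof.
apply: (big_morph (fun u => pact u s)) => [u w|]; first exact: pactD.
exact: pact0.
Qed.

Lemma pact_sign u s (b : bool) :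
  pact (u *~ (-1) ^+ b : permmod n lam) s = pact u s *~ (-1) ^+ b.
Proof. by case: b; rewrite ?expr1 ?mulrNz // pactN. Qed.

Lemma pact_tvec t s : is_tableau t ->
  pact (tvec (rows t) : permmod n lam) s = tvec (rows (tact t s)).
Proof.
move=> tP.
have hP : [exists u : filling, is_tableau u && (rows t == rows u)].
  by apply/existsP; exists t; rewrite tP eqxx.
rewrite /pact (bigD1 (Sub (rows t) hP : tabloid n lam)) //= ffunE SubK eqxx.
rewrite rows_tact big1 ?addr0 // => T.
by rewrite -val_eqE SubK => /negPf nT; rewrite !ffunE nT.
Qed.

End Tableaux.

(** * Permutations with prescribed values *)

Lemma perm_extend (T : finType) (p q : seq T) :
  uniq p -> uniq q -> size p = size q -> exists s : {perm T}, map s p = q.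
Proof.
elim: p q => [|x p IH] [|y q] //=; first by exists 1%g.
move=> /andP[xp up] /andP[yq uq] [/(IH q up uq)[s sE]].
(* Neither [s x] nor [y] occurs in [q], so the transposition corrects the image of [x] and leaves
   those of [p] alone. *)
exists (s * tperm (s x) y)%g; rewrite permM tpermL; congr (_ :: _).
rewrite -[RHS]sE; apply/eq_in_map => k kp; rewrite permM tpermD //.
  by rewrite (inj_eq perm_inj); apply: contraNneq xp => ->.
by apply: contraNneq yq => ->; rewrite -sE map_f.
Qed.

(** These permutations form a coset of the pointwise stabilizer of [p], the symmetric group on the
    complement. *)
Lemma card_perm_map (T : finType) (p q : seq T) :
  uniq p -> uniq q -> size p = size q ->
  #|[set s : {perm T} | map s p == q]| = (#|T| - size p)`!.
Proof.
move=> up uq pq; have [s0 s0E] := perm_extend up uq pq.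
have -> : [set s : {perm T} | map s p == q]
    = [set (s * s0)%g | s in perm_on [set x | x \notin p]].
  apply/setP => s; rewrite inE; apply/eqP/imsetP => [sE|[r rP ->]].
    exists (s * s0^-1)%g; last by rewrite mulgKV.
    apply/subsetP => x; rewrite !inE permM; apply: contraNN => xp.
    have /eq_in_map -> // : map s p = map s0 p by rewrite sE.
    by rewrite permK.
  rewrite -s0E; apply/eq_in_map => k kp; rewrite permM (out_perm rP) //.
  by rewrite inE negbK.
rewrite card_imset; last exact: mulIg.
rewrite card_perm; congr (_)`!.
have := cardsC [set x | x \in p]; rewrite cardsE (card_uniqP up) => <-.
by rewrite addKn; apply: eq_card => x; rewrite !inE.
Qed.

Lemma imset_tperm (T : finType) (A : {set T}) x y :
  (x \in A) = (y \in A) -> tperm x y @: A = A.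
Proof.
move=> xy; apply/setP => k.
rewrite -{1}[k](tpermK x y) mem_imset; last exact: perm_inj.
by case: tpermP => // ->.
Qed.

Lemma imset2_eq (T : finType) (s : {perm T}) (a b x y : T) : x != y ->
  (s @: [set a; b] == [set x; y])
    = (map s [:: a; b] == [:: x; y]) || (map s [:: a; b] == [:: y; x]).
Proof.
move=> xy; rewrite imsetU1 imset_set1 !eqseq_cons !andbT.
apply/eqP/idP => [E|/orP[]/andP[/eqP -> /eqP ->]] //; last by rewrite setUC.
have:= set21 x y; have:= set22 x y; have:= set21 (s a) (s b).
rewrite E -{2 3}E !inE => /orP[]/eqP -> Ey Ex.
  by move: Ey; rewrite eq_sym (negPf xy) /= eq_sym => ->; rewrite eqxx.
by move: Ex; rewrite (negPf xy) /= eq_sym => ->; rewrite eqxx orbT.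
Qed.

(** * Tableaux of shape (2^2, 1^(n-4)) *)

Section TwoColumnTableaux.
Variable n : nat.
Local Notation lam := (lam22 n).
Local Notation filling := (filling n lam).
Local Notation cell := (cell lam).
Implicit Types (t : filling) (s : 'S_n) (c : cell).

Let r0 : 'I_(size lam) := ord0.
Let r1 : 'I_(size lam) := Ordinal (isT : 1 < size lam)%N.
Let k0 : 'I_(head 0%N lam) := ord0.
Let k1 : 'I_(head 0%N lam) := Ordinal (isT : 1 < head 0%N lam)%N.

Definition c11 : cell := exist _ (r0, k0) isT.
Definition c12 : cell := exist _ (r0, k1) isT.
Definition c21 : cell := exist _ (r1, k0) isT.
Definition c22 : cell := exist _ (r1, k1) isT.

Variant cell_spec c : Prop :=
  | Cell11 of c = c11 | Cell12 of c = c12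
  | Cell21 of c = c21 | Cell22 of c = c22
  | CellLow of (1 < (val c).1)%N & (val c).2 = k0.

Lemma cellP c : cell_spec c.
Proof.
case: c => -[[i hi] [j hj]] /=.
move: i hi j hj => [|[|i]] hi [|[|j]] hj //= hc.
- by apply: Cell11; apply: val_inj; congr (_, _); apply: val_inj.
- by apply: Cell12; apply: val_inj; congr (_, _); apply: val_inj.
- by apply: Cell21; apply: val_inj; congr (_, _); apply: val_inj.
- by apply: Cell22; apply: val_inj; congr (_, _); apply: val_inj.
- by apply: CellLow => //; apply: val_inj.
exfalso; move: hc; rewrite nth_nseq; by case: ifP.
Qed.

Lemma row_1P c : (val c).1 = r0 -> c = c11 \/ c = c12.
Proof.
move=> E; case: (cellP c) => [|||| c1 _]; auto; last by rewrite E in c1.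
  by move=> cE; rewrite cE in E.
by move=> cE; rewrite cE in E.
Qed.

Lemma row_2P c : (val c).1 = r1 -> c = c21 \/ c = c22.
Proof.
move=> E; case: (cellP c) => [|||| c1 _]; auto; last by rewrite E in c1.
  by move=> cE; rewrite cE in E.
by move=> cE; rewrite cE in E.
Qed.

Definition second_col t : {set 'I_n} := [set t c12; t c22].

Lemma col_set_second t : col_set t k1 = second_col t.
Proof.
apply/setP => k; rewrite in_set2; apply/imsetP/orP => [[c cP ->]|].
  by case: (cellP c) cP => [->|->|->|->|_]; rewrite ?eqxx ?inE; auto => ->.
by case=> /eqP ->; [exists c12|exists c22]; rewrite ?inE.
Qed.

Lemma col_set_first t : is_tableau t -> col_set t k0 = ~: second_col t.
Proof.
move=> tP; apply/setP => k; rewrite -col_set_second inE.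
have [c ->] := tableau_onto k tP.
rewrite !mem_imset ?inE; try exact: tableau_inj.
by case: (val c).2 => -[|[]].
Qed.

Section Rows.
Variable t : filling.
Hypothesis tP : is_tableau t.

Lemma corners_uniq : uniq [:: t c11; t c12; t c21; t c22].
Proof.
by rewrite (map_inj_uniq (tableau_inj tP) [:: c11; c12; c21; c22]).
Qed.

Lemma mem_row_set c i : (t c \in row_set t i) = ((val c).1 == i).
Proof. by rewrite mem_imset ?inE //; exact: tableau_inj. Qed.

Let tau1 := tperm (t c11) (t c12).
Let tau2 := tperm (t c21) (t c22).

Lemma row_stabM s s' : s \in row_stab t -> s' \in row_stab t ->
  (s * s')%g \in row_stab t.
Proof.
rewrite !inE => /forallP E /forallP E'; apply/forallP => i.
by rewrite imset_permM (eqP (E i)).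
Qed.

Lemma tau1_row_stab : tau1 \in row_stab t.
Proof.
by rewrite inE; apply/forallP => i; rewrite imset_tperm // !mem_row_set.
Qed.

Lemma tau2_row_stab : tau2 \in row_stab t.
Proof.
by rewrite inE; apply/forallP => i; rewrite imset_tperm // !mem_row_set.
Qed.

(** Only the first two rows have more than one cell, so a row-preserving permutation is determined
    by whether it swaps each of these two pairs. *)
Lemma row_stab_mem s : 
  (s \in row_stab t) = (s \in [:: 1; tau1; tau2; tau1 * tau2]%g).
Proof.
apply/idP/idP => [sP|sP]; last first.
  have: s \in [:: 1; tau1; tau2; tau1 * tau2]%g := sP; rewrite !in_cons orbF.
  move=> /or4P[]/eqP->; rewrite ?tau1_row_stab ?tau2_row_stab //.
    by rewrite inE; apply/forallP => i; rewrite imset_perm1.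
  exact: row_stabM tau1_row_stab tau2_row_stab.
have sR c : exists2 c', s (t c) = t c' & (val c').1 = (val c).1.
  have [c' E] := tableau_onto (s (t c)) tP; exists c' => //.
  move: sP; rewrite inE => /forallP/(_ (val c).1)/eqP/setP/(_ (s (t c))).
  by rewrite mem_imset ?{1}E ?mem_row_set ?eqxx; [move/esym/eqP|exact: perm_inj].
have := corners_uniq; rewrite /= !inE !negb_or !andbT.
move=> /and3P[/and3P[n1 n2 n3] /andP[n4 n5] n6].
have low c : (1 < (val c).1)%N -> s (t c) = t c.
  move=> c1; have [c' -> E] := sR c; congr (t _); apply: val_inj => /=.
  rewrite [val c']surjective_pairing [val c]surjective_pairing E.
  congr (_, _).
  case: (cellP c) => [Ec|Ec|Ec|Ec|_ ->]; try by rewrite Ec in c1.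
  case: (cellP c') => [Ec|Ec|Ec|Ec|_ ->] //; by rewrite -E Ec in c1.
have row1 : (s (t c11) == t c11) && (s (t c12) == t c12)
         || (s (t c11) == t c12) && (s (t c12) == t c11).
  have [c Ec Ec1] := sR c11; have [c' Ec' Ec1'] := sR c12.
  rewrite Ec Ec' !(inj_eq (tableau_inj tP)).
  have : c != c'.
    apply: contraNneq n1 => cc'; apply/eqP/(@perm_inj _ s).
    by rewrite Ec Ec' cc'.
  by case: (row_1P Ec1) => ->; case: (row_1P Ec1') => ->; rewrite ?eqxx ?orbT.
have row2 : (s (t c21) == t c21) && (s (t c22) == t c22)
         || (s (t c21) == t c22) && (s (t c22) == t c21).
  have [c Ec Ec1] := sR c21; have [c' Ec' Ec1'] := sR c22.
  rewrite Ec Ec' !(inj_eq (tableau_inj tP)).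
  have : c != c'.
    apply: contraNneq n6 => cc'; apply/eqP/(@perm_inj _ s).
    by rewrite Ec Ec' cc'.
  by case: (row_2P Ec1) => ->; case: (row_2P Ec1') => ->; rewrite ?eqxx ?orbT.
have ext (r : 'S_n) : s (t c11) = r (t c11) -> s (t c12) = r (t c12) ->
    s (t c21) = r (t c21) -> s (t c22) = r (t c22) ->
    (forall c, (1 < (val c).1)%N -> r (t c) = t c) -> s = r.
  move=> e1 e2 e3 e4 el; apply/permP => k; have [c ->] := tableau_onto k tP.
  by case: (cellP c) => [->|->|->|->|c1 _] //; rewrite low // el.
have D1 c : (1 < (val c).1)%N -> tau1 (t c) = t c.
  by move=> c1; rewrite tpermD // (inj_eq (tableau_inj tP));
    apply: contraTneq c1 => <-.
have D2 c : (1 < (val c).1)%N -> tau2 (t c) = t c.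
  by move=> c1; rewrite tpermD // (inj_eq (tableau_inj tP));
    apply: contraTneq c1 => <-.
have T1 : (tau1 (t c11) = t c12) * (tau1 (t c12) = t c11)
        * (tau1 (t c21) = t c21) * (tau1 (t c22) = t c22).
  by rewrite /tau1 tpermL tpermR !tpermD.
have T2 : (tau2 (t c21) = t c22) * (tau2 (t c22) = t c21)
        * (tau2 (t c11) = t c11) * (tau2 (t c12) = t c12).
  by rewrite /tau2 tpermL tpermR !tpermD // eq_sym.
case/orP: row1 => /andP[/eqP e1 /eqP e2]; case/orP: row2 => /andP[/eqP e3 /eqP e4];
  apply/or4P.
- by apply: Or41; apply/eqP/ext; rewrite ?perm1 // => c; rewrite perm1.
- by apply: Or43; apply/eqP/ext => //; rewrite ?T2.
- by apply: Or42; apply/eqP/ext => //; rewrite ?T1.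
apply: Or44; apply/eqP/ext; rewrite ?permM ?T1 ?T2 // => c c1.
by rewrite permM D1 ?D2.
Qed.

Lemma big_row_stab (V : nmodType) (F : 'S_n -> V) :
  \sum_(s in row_stab t) F s = F 1%g + F tau1 + F tau2 + F (tau1 * tau2)%g.
Proof.
rewrite (eq_bigl _ _ row_stab_mem) -big_uniq.
  by rewrite !big_cons big_nil /= addr0 !addrA.
(* The four permutations are told apart by the images of the two entries of the second column. *)
apply: (@map_uniq _ _ (fun s : 'S_n => (s (t c12), s (t c22)))) => /=.
have := corners_uniq; rewrite /= !inE !negb_or !andbT !xpair_eqE.
move=> /and3P[/and3P[n1 n2 n3] /andP[n4 n5] n6].
have T1 : (tau1 (t c12) = t c11) * (tau1 (t c21) = t c21)
        * (tau1 (t c22) = t c22) * (tau1 (t c11) = t c12).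
  by rewrite /tau1 tpermL tpermR !tpermD.
have T2 : (tau2 (t c22) = t c21) * (tau2 (t c11) = t c11)
        * (tau2 (t c12) = t c12) * (tau2 (t c21) = t c22).
  by rewrite /tau2 tpermL tpermR !tpermD // eq_sym.
rewrite !permM !T1 !T2 !perm1 !eqxx !andbT !(eq_sym (t c12)) !(eq_sym (t c22)).
by rewrite (negPf n1) (negPf n6).
Qed.

Lemma odd_taus : (odd_perm tau1 = true) * (odd_perm tau2 = true).
Proof.
have := corners_uniq; rewrite /= !inE !negb_or !andbT.
by move=> /and3P[/and3P[n1 n2 n3] _ n6]; rewrite !odd_tperm n1 n6.
Qed.

(** These pairs meet the second column in 1, 1 and 0 points; together with the signs this is all
    that the form sees of the row stabilizer. *)
Lemma second_col_taus :
  (tau1 @: second_col t = [set t c11; t c22])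
  * (tau2 @: second_col t = [set t c12; t c21])
  * ((tau1 * tau2)%g @: second_col t = [set t c11; t c21]).
Proof.
have := corners_uniq; rewrite /= !inE !negb_or !andbT.
move=> /and3P[/and3P[n1 n2 n3] /andP[n4 n5] n6].
have T1 : (tau1 (t c12) = t c11) * (tau1 (t c22) = t c22).
  by rewrite /tau1 tpermR !tpermD.
have T2 : (tau2 (t c22) = t c21) * (tau2 (t c11) = t c11)
        * (tau2 (t c12) = t c12).
  by rewrite /tau2 tpermR !tpermD // eq_sym.
by rewrite imset_permM /second_col !imsetU1 !imset_set1 !T1 !T2.
Qed.

End Rows.
End TwoColumnTableaux.
Arguments c11 {n}.
Arguments c12 {n}.
Arguments c21 {n}.
Arguments c22 {n}.

(** * Counting permutations *)

Lemma card_set_or (T : finType) (P Q : pred T) :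
  (forall x, P x -> Q x -> false) ->
  #|[set x | P x || Q x]| = (#|[set x | P x]| + #|[set x | Q x]|)%N.
Proof.
move=> PQ; have -> : [set x | P x || Q x] = [set x | P x] :|: [set x | Q x].
  by apply/setP => x; rewrite !inE.
rewrite cardsU; suff -> : [set x | P x] :&: [set x | Q x] = set0.
  by rewrite cards0 subn0.
apply/setP => x; rewrite !inE; apply/negP => /andP[Px Qx].
by have := PQ _ Px Qx.
Qed.

Section CountPermutations.
Variable T : finType.
Implicit Types (s : {perm T}) (X Y A B : {set T}) (a b c d : T).

Lemma card_imset_cap_eq0 A B X Y : #|A :&: B| != #|X :&: Y| ->
  #|[set s : {perm T} | (s @: A == X) && (s @: B == Y)]| = 0%N.
Proof.
move=> ne; apply: eq_card0 => s; rewrite inE; apply/negP.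
case/andP=> /eqP sA /eqP sB; case/negP: ne.
by rewrite -sA -sB -imsetI ?card_imset //; [exact: perm_inj|
  move=> ? ? _ _; exact: perm_inj].
Qed.

Lemma card_imset_pair a b X Y : a != b -> #|X| = 2%N -> #|Y| = 2%N ->
  #|[set s : {perm T} | (s @: [set a; b] == X) && (s @: [set a; b] == Y)]|
    = ((X == Y) * (2 * (#|T| - 2)`!))%N.
Proof.
move=> ab /eqP/cards2P[x [y [xy ->]]] Y2; case: eqVneq => [<-|XY]; last first.
  apply: eq_card0 => s; rewrite inE; apply/negP => /andP[/eqP E /eqP E'].
  by case/eqP: XY; rewrite -E.
have -> : [set s : {perm T} | (s @: [set a; b] == [set x; y])
                         && (s @: [set a; b] == [set x; y])]
    = [set s : {perm T} | (map s [:: a; b] == [:: x; y])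
                       || (map s [:: a; b] == [:: y; x])].
  by apply/setP => s; rewrite !inE andbb imset2_eq.
rewrite card_set_or => [|s /eqP -> /eqP[yx _]]; last by rewrite yx eqxx in xy.
by rewrite !card_perm_map /= ?inE ?ab ?xy 1?eq_sym ?xy // mul1n mul2n addnn.
Qed.

(** The shared point [b] must go to the only common point of [X] and [Y], which forces the images of
    [a] and [c]. *)
Lemma card_imset_path a b c X Y : uniq [:: b; a; c] -> #|X| = 2%N -> #|Y| = 2%N ->
  #|[set s : {perm T} | (s @: [set b; a] == X) && (s @: [set b; c] == Y)]|
    = ((#|X :&: Y| == 1) * (#|T| - 3)`!)%N.
Proof.
move=> u X2 Y2; have := u; rewrite /= !inE negb_or !andbT => /andP[/andP[ba bc] ac].
case: eqVneq => [/eqP/cards1P[x XY]|XY]; last first.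
  rewrite card_imset_cap_eq0 // eq_sym; move: XY.
  suff -> : [set b; a] :&: [set b; c] = [set b] by rewrite cards1.
  apply/setP => k; rewrite !inE -orb_andr; case: eqVneq => //= _.
  by apply/negP => /andP[/eqP -> /eqP/esym E]; rewrite E eqxx in ac.
have [xX xY] : x \in X /\ x \in Y by apply/andP; rewrite -in_setI XY inE.
have [y Xy] : exists y, X :\ x = [set y].
  by apply/cards1P; move: (cardsD1 x X); rewrite xX X2 add1n => -[<-].
have [z Yz] : exists z, Y :\ x = [set z].
  by apply/cards1P; move: (cardsD1 x Y); rewrite xY Y2 add1n => -[<-].
have EX : X = [set x; y] by rewrite -(setD1K xX) Xy.
have EY : Y = [set x; z] by rewrite -(setD1K xY) Yz.
have xy : x != y by move: X2; rewrite EX cards2; case: eqP.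
have xz : x != z by move: Y2; rewrite EY cards2; case: eqP.
have yz : y != z.
  apply: contraNneq xy => yz; have : y \in X :&: Y by rewrite EX EY -yz setIid set22.
  by rewrite XY inE eq_sym.
rewrite mul1n -(@card_perm_map T [:: b; a; c] [:: x; y; z]) //; last first.
  by rewrite /= !inE negb_or xy xz yz.
apply: eq_card => s; rewrite !inE EX EY !imset2_eq // !eqseq_cons !andbT.
apply/idP/idP => [/andP[]|/and3P[-> -> ->]] //.
case/orP => /andP[/eqP e1 /eqP e2]; case/orP => /andP[/eqP e3 /eqP e4].
- by rewrite e1 e2 e4 !eqxx.
- by move: e3; rewrite e1 => /eqP; rewrite (negPf xz).
- by move: e3; rewrite e1 => /eqP; rewrite eq_sym (negPf xy).
by move: e3; rewrite e1 => /eqP; rewrite (negPf yz).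
Qed.

(** Each of the two pairs can be mapped in two ways, whence four disjoint families with four
    prescribed values. *)
Lemma card_imset_disjoint a b c d X Y :
  uniq [:: a; b; c; d] -> #|X| = 2%N -> #|Y| = 2%N ->
  #|[set s : {perm T} | (s @: [set a; b] == X) && (s @: [set c; d] == Y)]|
    = ((#|X :&: Y| == 0) * (4 * (#|T| - 4)`!))%N.
Proof.
move=> u X2 Y2; have := u; rewrite /= !inE !negb_or !andbT.
case/and3P=> [/and3P[ab ac ad] /andP[bc bd] cd].
case: eqVneq => [/eqP|XY]; last first.
  rewrite card_imset_cap_eq0 // eq_sym; move: XY.
  suff -> : [set a; b] :&: [set c; d] = set0 by rewrite cards0.
  apply/setP => k; rewrite !inE; apply/negP.
  by case/andP => /orP[]/eqP-> /orP[]/eqP E; move: ab ac ad bc bd cd; rewrite E ?eqxx.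
move: X2 Y2 => /eqP/cards2P[x [y [xy ->]]] /eqP/cards2P[z [w [zw ->]]].
rewrite cards_eq0 => /eqP/setP XY.
have := XY x; have := XY y; rewrite !inE !eqxx ?orbT /= => /norP[yz yw] /norP[xz xw].
have -> : [set s : {perm T} | (s @: [set a; b] == [set x; y])
                         && (s @: [set c; d] == [set z; w])]
  = [set s : {perm T} |
      ((map s [:: a; b; c; d] == [:: x; y; z; w])
       || (map s [:: a; b; c; d] == [:: x; y; w; z]))
      || ((map s [:: a; b; c; d] == [:: y; x; z; w])
       || (map s [:: a; b; c; d] == [:: y; x; w; z]))].
  apply/setP => s; rewrite !inE !imset2_eq // !eqseq_cons !andbT.
  by rewrite !andb_orr !andb_orl !andbA orbACA.
rewrite !card_set_or => [|s /eqP[_ _ e _] /eqP[_ _ f _]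
  |s /eqP[_ _ e _] /eqP[_ _ f _]|s /orP[]/eqP[e _ _ _] /orP[]/eqP[f _ _ _]];
  try by move: zw; rewrite -e f eqxx.
all: try by move: xy; rewrite -e f eqxx.
rewrite !card_perm_map /=; try by [].
  by rewrite mul1n !addnn -!mul2n mulnA.
all: rewrite !inE !negb_or ?xy ?xz ?xw ?yz ?yw ?zw //=.
all: by rewrite ?(eq_sym y x) ?(eq_sym w z) ?xy ?xz ?xw ?yz ?yw ?zw.
Qed.

End CountPermutations.

(** * Polytabloids as alternating sums over the symmetric group *)

Lemma imset_permC (T : finType) (s : {perm T}) (A : {set T}) :
  s @: (~: A) = ~: (s @: A).
Proof.
apply/setP => k; rewrite -[k](permKV s) inE !mem_imset ?inE //; exact: perm_inj.
Qed.

Section AlternatingSums.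
Variable n : nat.
Local Notation lam := (lam22 n).
Local Notation filling := (filling n lam).
Implicit Types (t : filling) (s : 'S_n) (X Y : {set 'I_n}).

Lemma second_col_tact t s : second_col (tact t s) = s @: second_col t.
Proof. by rewrite /second_col !ffunE imsetU1 imset_set1. Qed.

(** The first column is the complement of the second, so stabilizing one stabilizes both. *)
Lemma col_stab_second t s : is_tableau t ->
  (s \in col_stab t) = (s @: second_col t == second_col t).
Proof.
move=> tP; rewrite inE; apply/forallP/eqP => [|E j].
  by move=> /(_ (Ordinal (isT : 1 < 2)%N))/eqP; rewrite col_set_second.
case: j => -[|[|//]] hj.
  have -> : Ordinal hj = ord0 by exact: val_inj.
  by rewrite col_set_first // imset_permC E.
by rewrite (bool_irrelevance hj isT) col_set_second E.
Qed.

Variable t0 : filling.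
Hypothesis t0P : is_tableau t0.

(* By [polytabloid_altsum], the common value, up to sign, of the polytabloids of
   all tableaux whose second column has the set of entries [X]. *)
Definition altsum X : permmod n lam :=
  \sum_(s : 'S_n | s @: second_col t0 == X) tvec (rows (tact t0 s)) *~ (-1) ^+ s.

Lemma mulrz_signM (V : zmodType) (v : V) s s' :
  v *~ (-1) ^+ (s * s')%g = v *~ (-1) ^+ s *~ (-1) ^+ s'.
Proof. by rewrite odd_permM signr_addb mulrzA. Qed.

(** Writing a column stabilizer element as [s^-1 * w] turns the defining sum into one over the coset
    of all [w] that agree with [s] on the second column as a set. *)
Lemma polytabloid_altsum s :
  polytabloid (tact t0 s) = altsum (s @: second_col t0) *~ (-1) ^+ s.
Proof.
have tP := tact_tableau s t0P.
rewrite /altsum mulrz_suml /polytabloid (reindex_inj (mulgI s^-1%g)) /=.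
apply: eq_big => w; last first.
  by rewrite -tactM mulKVg mulrz_signM odd_permV -!mulrzA mulrC.
by rewrite col_stab_second // second_col_tact -imset_permM mulKVg.
Qed.

Lemma pact_altsum X s :
  pact (altsum X) s = altsum (s @: X) *~ (-1) ^+ s.
Proof.
rewrite /altsum pact_sum mulrz_suml [RHS](reindex_inj (mulIg s)) /=.
apply: eq_big => w => [|_].
  by rewrite imset_permM (inj_eq (@imset_perm_inj _ s)).
rewrite pact_sign pact_tvec ?tact_tableau // -tactM mulrz_signM -mulrzA.
by rewrite -signr_addb addbb.
Qed.

(** The tabloids at [s] and [w] coincide iff [w = r * s] with [r] in the row stabilizer. The product
    of their signs is then the sign of [r], and [w] takes the second column first through [r], then
    through [s]. *)
Lemma spform_altsum X Y :
  spform (altsum X) (altsum Y) = \sum_(r in row_stab t0) (-1) ^+ r *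
    #|[set s : 'S_n | (s @: second_col t0 == X)
                   && (s @: (r @: second_col t0) == Y)]|%:R.
Proof.
have cardE (P : pred 'S_n) : #|[set s | P s]|%:R = \sum_s (P s)%:R :> int.
  by rewrite -sum1_card natr_sum big_mkcond; apply: eq_bigr => s _;
    rewrite inE; case: (P s).
transitivity (\sum_(s : 'S_n) \sum_(r in row_stab t0) ((-1) ^+ r *
    ((s @: second_col t0 == X) && (s @: (r @: second_col t0) == Y))%:R : int));
  last first.
  by rewrite exchange_big; apply: eq_bigr => w _; rewrite cardE mulr_sumr.
rewrite /altsum spform_suml big_mkcond; apply: eq_bigr => s _.
case: eqP => _ /=; last by rewrite big1 // => w _; rewrite mulr0.
rewrite spformZl spform_sumr mulr_sumr (reindex_inj (mulIg s)) /=.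
rewrite big_mkcond [RHS]big_mkcond; apply: eq_bigr => w _.
rewrite spformZr tvec_rows ?tact_tableau // rows_tact_eq mulgK imset_permM.
case: eqP => _; case: ifP => _; rewrite ?mulr0 ?mulr1 //.
by rewrite odd_permM signr_addb mulrCA -signr_addb addbb mulr1.
Qed.

Lemma subn_ge4 (m : nat) : (4 <= m)%N ->
  [/\ m - 1 = (m - 4).+3, m - 2 = (m - 4).+2 & m - 3 = (m - 4).+1]%N.
Proof. by move=> m4; split; lia. Qed.

(** The row permutations contribute 2(n-2)! if X = Y, twice -(n-3)! if the pairs share one point,
    and 4(n-4)! if they are disjoint. Divided by 2(n-4)!, these are (n-2)(n-3), -(n-3) and 2, which
    the closed formula interpolates. *)
Lemma gram_altsum X Y : #|X| = 2%N -> #|Y| = 2%N ->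
  spform (altsum X) (altsum Y) = (2 * (n - 4)`!)%:R *
    (((n - 1) * (n - 2))%:R * (X == Y)%:R - (n - 1)%:R * #|X :&: Y|%:R + 2%:R).
Proof.
move=> X2 Y2; have := corners_uniq t0P => u; have := u; rewrite /= !inE !negb_or !andbT.
move=> /and3P[/and3P[n1 n2 n3] /andP[n4 n5] n6].
(* The bound is read off from the four distinct corner entries. *)
have n4_ge : (4 <= n)%N.
  pose s4 := [:: t0 c11; t0 c12; t0 c21; t0 c22].
  rewrite -[n]card_ord; apply: leq_trans (max_card (mem s4)).
  by rewrite (card_uniqP u).
have N0 := card_imset_pair n5 X2 Y2.
have u1 : uniq [:: t0 c22; t0 c12; t0 c11].
  by rewrite /= !inE negb_or !(eq_sym _ (t0 c11)) n1 n3 eq_sym n5.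
have u2 : uniq [:: t0 c12; t0 c22; t0 c21].
  by rewrite /= !inE negb_or n4 n5 eq_sym n6.
have u3 : uniq [:: t0 c12; t0 c22; t0 c11; t0 c21].
  by rewrite /= !inE !negb_or n5 n4 n2 !(eq_sym _ (t0 c11)) n1 n3 eq_sym n6.
have := card_imset_path u1 X2 Y2.
rewrite (setUC [set t0 c22]) (setUC [set t0 c22] [set t0 c11]) => N1.
have N2 := card_imset_path u2 X2 Y2; have N3 := card_imset_disjoint u3 X2 Y2.
rewrite spform_altsum (big_row_stab t0P) imset_perm1 !(second_col_taus t0P).
rewrite odd_permM !(odd_taus t0P) odd_perm1 /= !expr1 expr0 !mul1r !mulN1r.
rewrite /second_col N0 N1 N2 N3.
rewrite card_ord.
have [-> -> ->] := subn_ge4 n4_ge; set m := (n - 4)%N.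
rewrite !factS; set F := (m`!)%N.
have [<-|XY] := eqVneq X Y; first by rewrite setIid X2 /=; ring.
have : (#|X :&: Y| < 2)%N.
  rewrite -X2 proper_card // properEneq subsetIl andbT.
  apply: contraNneq XY => /setIidPl XY; rewrite eqEcard XY.
  by rewrite X2 Y2.
by case: #|X :&: Y| => [|[|//]] _ /=; ring.
Qed.

End AlternatingSums.

(** An adjacent transposition can disturb the increasing order only between [x] and its successor,
    and [x] is not in the list. Hence the first column stays sorted when an entry of the second
    column moves by one. *)
Lemma map_tperm_succ n (x y : 'I_n) (P P' : pred 'I_n) :
  y = x.+1 :> nat -> ~~ P x -> (forall k, P' k = P (tperm x y k)) ->
  map (tperm x y) (filter P (enum 'I_n)) = filter P' (enum 'I_n).
Proof.
move=> yx Px P'E; have enum_lt : sorted (fun i j : 'I_n => i < j)%N (enum 'I_n).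
  have : sorted ltn (map val (enum 'I_n)) by rewrite val_enum_ord iota_ltn_sorted.
  by rewrite sorted_map.
have lt_tr : transitive (fun i j : 'I_n => i < j)%N.
  by move=> ? ? ?; exact: ltn_trans.
apply: (@irr_sorted_eq _ (fun i j : 'I_n => i < j)%N).
- exact: lt_tr.
- by move=> ?; exact: ltnn.
- have := sorted_filter lt_tr P enum_lt.
  rewrite sorted_map; apply: (sub_in_sorted _ (allss (filter P (enum 'I_n)))) => k l.
  rewrite !mem_filter => /andP[Pk _] /andP[Pl _] /= kl.
  have [kx lx] : k != x /\ l != x by split; [apply: contraNneq Px => <-|
    apply: contraNneq Px => <-].
  rewrite -!val_eqE /= in kx lx.
  case: tpermP => [/(congr1 val)/= E|/(congr1 val)/= E|/eqP + /eqP];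
  case: tpermP => [/(congr1 val)/= F|/(congr1 val)/= F|/eqP + /eqP];
  rewrite -?val_eqE /=; lia.
- exact: (sorted_filter lt_tr).
move=> k; rewrite -[k](tpermK x y) (mem_map perm_inj).
by rewrite tpermK mem_filter [in RHS]mem_filter P'E !mem_enum.
Qed.

(** * Signs of the standard tableaux attached to a second column *)

Section Brackets.
Variable n : nat.
Hypothesis n4 : (4 <= n)%N.
Local Notation lam := (lam22 n).
Local Notation filling := (filling n lam).
Implicit Types (t : filling) (s : 'S_n) (X Y : {set 'I_n}) (i j : 'I_n).

Let rest i j := [seq k <- enum 'I_n | k \notin [:: i; j]].

Lemma size_lam22 : size lam = (n - 2)%N.
Proof. by rewrite /= size_nseq; lia. Qed.

Lemma size_rest i j : i != j -> size (rest i j) = (n - 2)%N.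
Proof.
move=> ij; rewrite size_filter -[in RHS](size_enum_ord n).
rewrite -(count_predC (mem [:: i; j]) (enum 'I_n)).
suff -> : count (mem [:: i; j]) (enum 'I_n) = 2%N by rewrite addKn.
rewrite -size_filter -[RHS]/(size [:: i; j]); apply: perm_size.
apply: uniq_perm => [||k]; first by apply: filter_uniq; exact: enum_uniq.
  by rewrite /= mem_seq1 ij.
by rewrite mem_filter mem_enum andbT.
Qed.

Lemma uniq_rest i j : uniq (rest i j).
Proof. by apply: filter_uniq; exact: enum_uniq. Qed.

Lemma first_col_cell (r : 'I_(size lam)) :
  exists c : cell lam, (((val c).1 = r) * ((val c).2 = 0%N :> nat))%type.
Proof.
suff h : ((ord0 : 'I_(head 0%N lam)) < nth 0%N lam r)%N by exists (exist _ (r, ord0) h).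
by case: r => -[|[|r]] //= hr; rewrite nth_nseq; move: hr;
  rewrite /= size_nseq !ltnS => ->.
Qed.

Lemma ab_tableauP i j : i != j -> is_tableau (ab_tableau i j).
Proof.
move=> ij; have sz := size_rest ij.
have rest_mem (c : cell lam) : nth i (rest i j) (val c).1 \in rest i j.
  by apply: mem_nth; rewrite sz -size_lam22.
have inj : injective (ab_tableau i j).
  move=> c c'; rewrite !ffunE; set u := nth _ _ _; set u' := nth _ _ _.
  have E1 (d : cell lam) : (val d).2 != 0%N :> nat -> d = c12 \/ d = c22.
    by case: (cellP d) => [->|->|->|->|_ ->]; auto.
  have [c0|/E1 cE] := eqVneq ((val c).2 : nat) 0%N;
    have [c'0|/E1 c'E] := eqVneq ((val c').2 : nat) 0%N.
  - rewrite /u /u'; move/eqP; rewrite nth_uniq ?sz -?size_lam22 ?uniq_rest // => /eqP cc'.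
    apply: val_inj; rewrite [val c]surjective_pairing [val c']surjective_pairing.
    by congr (_, _); apply: val_inj; [exact: cc'|rewrite /= c0].
  - move=> E; have := rest_mem c; rewrite -/u E mem_filter !inE negb_or.
    by case: c'E => -> /=; rewrite eqxx ?andbF.
  - move/esym=> E; have := rest_mem c'; rewrite -/u' E mem_filter !inE negb_or.
    by case: cE => -> /=; rewrite eqxx ?andbF.
  by case: cE => ->; case: c'E => -> //= /eqP; rewrite ?(negPf ij) // eq_sym (negPf ij).
apply/andP; split; first by apply/injectiveP.
apply/forallP => k; apply/codomP.
have [->|ki] := eqVneq k i; first by exists c12; rewrite ffunE.
have [->|kj] := eqVneq k j; first by exists c22; rewrite ffunE.
have kr : k \in rest i j by rewrite mem_filter !inE negb_or ki kj mem_enum.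
have hr : (index k (rest i j) < size lam)%N by rewrite size_lam22 -sz index_mem.
have [c cE] := first_col_cell (Ordinal hr).
by exists c; rewrite ffunE !cE eqxx nth_index.
Qed.

Lemma ab_tableau_tact i j s : i != j -> map s (rest i j) = rest (s i) (s j) ->
  ab_tableau (s i) (s j) = tact (ab_tableau i j) s.
Proof.
move=> ij E; apply/ffunP => c; rewrite !ffunE -/(rest _ _) -/(rest _ _) -E.
case: ifP => _; last by case: ifP.
by rewrite (nth_map i) // size_rest // -size_lam22.
Qed.

Lemma ab_tableau_succ1 i i' j : i' = i.+1 :> nat -> i != j -> i' != j ->
  ab_tableau i' j = tact (ab_tableau i j) (tperm i i').
Proof.
move=> ii' ij i'j; have ji : tperm i i' j = j by rewrite tpermD.
have := @ab_tableau_tact i j (tperm i i') ij; rewrite ji tpermL; apply.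
apply: map_tperm_succ => // [|k]; first by rewrite !inE eqxx.
have E l : (k == l) = (tperm i i' k == tperm i i' l).
  by rewrite (inj_eq perm_inj).
by rewrite !inE (E i') (E j) tpermR ji.
Qed.

Lemma ab_tableau_succ2 i j j' : j' = j.+1 :> nat -> i != j -> i != j' ->
  ab_tableau i j' = tact (ab_tableau i j) (tperm j j').
Proof.
move=> jj' ij ij'; have ji : tperm j j' i = i by rewrite tpermD // eq_sym.
have := @ab_tableau_tact i j (tperm j j') ij; rewrite ji tpermL; apply.
apply: map_tperm_succ => // [|k]; first by rewrite !inE eqxx orbT.
have E l : (k == l) = (tperm j j' k == tperm j j' l).
  by rewrite (inj_eq perm_inj).
by rewrite !inE (E i) (E j') tpermR ji.
Qed.

Definition ord_1st : 'I_n := Ordinal (ltnW (ltnW (ltnW n4))).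
Definition ord_2nd : 'I_n := Ordinal (ltnW (ltnW n4)).
Definition tableau12 : filling := ab_tableau ord_1st ord_2nd.

(** Lowering an entry of the second column by one is an adjacent transposition, so the sign changes
    with each unit of [i + j], starting from the sum 1 of [tableau12]. *)
Lemma ab_tableau_base i j : (i < j)%N ->
  exists2 s, ab_tableau i j = tact tableau12 s & odd_perm s = odd (i + j).+1.
Proof.
move=> ij; have [m] := ubnP (i + j)%N; elim: m => // m IH in i j ij *.
(* Lowering [i] to 0 before touching [j] keeps [i < j] throughout. *)
case: i ij => -[|i] hi /= ij ijm.
  case: j ij ijm => -[|[|j]] hj //= _ ijm.
    exists 1%g; rewrite ?odd_perm1 // tact1.
    by congr ab_tableau; exact: val_inj.
  have [|s sE so] := IH (Ordinal hi) (Ordinal (ltnW hj)) isT; first by rewrite /=; lia.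
  exists (s * tperm (Ordinal (ltnW hj)) (Ordinal hj))%g.
    by rewrite tactM -sE -ab_tableau_succ2.
  by rewrite odd_permM so odd_tperm -val_eqE /=; lia.
have [||s sE so] := IH (Ordinal (ltnW hi)) j _ _; rewrite /=; try by lia.
exists (s * tperm (Ordinal (ltnW hi)) (Ordinal hi))%g.
  by rewrite tactM -sE -ab_tableau_succ1 // -val_eqE /=; lia.
by rewrite odd_permM so odd_tperm -val_eqE /=; lia.
Qed.

End Brackets.

(** * Edges of the complete graph *)

Lemma eq_pairE (i j k l : nat) : i != j -> k != l ->
  ((((i == k) || (i == l)) && ((j == k) || (j == l))
    = (i == k) && (j == l) || (i == l) && (j == k))
  * ((((i == k) || (i == l)) + ((j == k) || (j == l)))%N
    = ((i == k) + (i == l) + (j == k) + (j == l))%N))%type.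
Proof.
move=> /eqP ij /eqP kl.
by case: (i =P k); case: (i =P l); case: (j =P k); case: (j =P l) => *; split => //;
  exfalso; congruence.
Qed.

Section Edges.
Variable n : nat.
Hypothesis n4 : (4 <= n)%N.
Local Notation lam := (lam22 n).
Local Notation filling := (filling n lam).
Local Notation t12 := (tableau12 n4).
Implicit Types (t : filling) (s : 'S_n) (X Y : {set 'I_n}) (i j : 'I_n).

(* The sign makes [br n a b = edge a b *~ (-1) ^+ (a + b)] for [a < b]; the lock
   hides the opposite from rewriting with [opprK] and the like. *)
Definition edge (a b : nat) : permmod n lam :=
  locked (- altsum t12 [set k : 'I_n | (k.+1 == a) || (k.+1 == b)]).

Lemma edgeC a b : edge a b = edge b a.
Proof.
rewrite /edge -!lock; congr (- altsum _ _); by apply/setP => k; rewrite !inE orbC.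
Qed.

Lemma edge_ord i j : edge i.+1 j.+1 = - altsum t12 [set i; j].
Proof.
rewrite /edge -!lock; congr (- altsum _ _); by apply/setP => k; rewrite !inE !eqSS.
Qed.

Lemma tableau12P : is_tableau t12.
Proof. exact: ab_tableauP. Qed.

Lemma second_col_ab i j : second_col (ab_tableau i j) = [set i; j].
Proof. by rewrite /second_col !ffunE. Qed.

Lemma ex_ord a : (1 <= a <= n)%N -> exists i : 'I_n, a = i.+1.
Proof. by case: a => // a /= an; exists (Ordinal an). Qed.

Lemma br_ord i j : br n i.+1 j.+1 = polytabloid (ab_tableau i j).
Proof. by rewrite /br /abtab /= !valK. Qed.

Lemma br_rho_ord i j : br_rho n i.+1 j.+1 =
  \sum_(s in row_stab (ab_tableau i j)) pact (br n i.+1 j.+1) s.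
Proof. by rewrite /br_rho /abtab /= !valK. Qed.

(** The sign found in [ab_tableau_base] is (-1)^(a+b+1) in terms of the entries; the opposite in
    [edge] absorbs one -1. *)
Lemma br_edge a b : (1 <= a < b)%N -> (b <= n)%N ->
  br n a b = edge a b *~ (-1) ^+ (a + b).
Proof.
move=> /andP[a1 ab] bn.
have [i Ea] : exists i : 'I_n, a = i.+1 by apply: ex_ord; lia.
have [j Eb] : exists j : 'I_n, b = j.+1 by apply: ex_ord; lia.
rewrite Ea Eb br_ord edge_ord.
have [|s sE so] := ab_tableau_base n4 (i := i) (j := j); first by lia.
rewrite sE (polytabloid_altsum tableau12P) -second_col_tact -sE second_col_ab.
by rewrite so signr_odd addSn addnS [in RHS]exprS mulN1r mulrNz mulNrz opprK.
Qed.

(** The row stabilizer exchanges [i] with its row neighbour [u], and [j] with [v]. With signs, the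
    four images form an alternating 4-cycle through [i], [j], [u], [v]. *)
Lemma br_rho_edge i j (u v : 'I_n) : (i < j)%N ->
  ab_tableau i j c11 = u -> ab_tableau i j c21 = v ->
  br_rho n i.+1 j.+1 = (edge i.+1 j.+1 - edge u.+1 j.+1 - edge i.+1 v.+1
    + edge u.+1 v.+1) *~ (-1) ^+ (i.+1 + j.+1).
Proof.
move=> ij tu tv; have tP : is_tableau (ab_tableau i j).
  by apply: ab_tableauP => //; rewrite neq_ltn ij.
have tE : (ab_tableau i j c12 = i) * (ab_tableau i j c22 = j).
  by rewrite !ffunE.
rewrite br_rho_ord br_edge // edge_ord.
have pact_br s : pact (- altsum t12 [set i; j] *~ (-1) ^+ (i.+1 + j.+1)) s
          = (- altsum t12 (s @: [set i; j]) *~ (-1) ^+ s) *~ (-1) ^+ (i.+1 + j.+1).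
  rewrite -(signr_odd _ (_ + _)) pact_sign pactN pact_altsum; last exact: tableau12P.
  by rewrite !mulNrz.
rewrite (eq_bigr _ (fun s _ => pact_br s)) -mulrz_suml (big_row_stab tP).
rewrite imset_perm1 odd_permM !(odd_taus tP).
rewrite -second_col_ab !(second_col_taus tP) tu tv !tE odd_perm1 /=.
by rewrite !edge_ord second_col_ab !mulrN1z !opprK expr0 mulr1z.
Qed.

Lemma ab_tableau_col1 i j (r : 'I_n) k l m :
  [seq x <- iota 0 n | x \notin [:: val i; val j]] = [:: k, l & m] ->
  val (ab_tableau i j c11) = k /\ val (ab_tableau i j c21) = l.
Proof.
move=> E; rewrite !ffunE /=; set w := [seq _ <- _ | _].
have : map val w = [:: k, l & m].
  by rewrite -E -val_enum_ord filter_map; congr (map _ _).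
by case: w => [|x [|y w]] //= [-> ->].
Qed.

Lemma br_rho_edge12 a b : (3 <= a < b)%N -> (b <= n)%N ->
  br_rho n a b =
    (edge a b - edge 1 b - edge a 2 + edge 1 2) *~ (-1) ^+ (a + b).
Proof.
move=> /andP[a1 ab] bn.
have [i Ea] : exists i : 'I_n, a = i.+1 by apply: ex_ord; lia.
have [j Eb] : exists j : 'I_n, b = j.+1 by apply: ex_ord; lia.
have [] := @ab_tableau_col1 i j i 0%N 1%N
  [seq x <- iota 2 (n - 2) | x \notin [:: val i; val j]].
  have -> : iota 0 n = [:: 0, 1 & iota 2 (n - 2)]%N.
    by have {1}-> : n = (n - 2).+2 by lia.
  have : (2 <= val i < val j)%N by rewrite /=; lia.
  by move: (val i) (val j) => [|[|x]] [|[|y]].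
subst a b; move=> E1 E2; rewrite (@br_rho_edge i j _ _ _ erefl erefl); last by lia.
by rewrite E1 E2.
Qed.

(** With 2 in the second column, the first column begins with 1 and 3 instead of 1 and 2. *)
Lemma br_rho_edge13 b : (4 <= b <= n)%N ->
  br_rho n 2 b =
    (edge 2 b - edge 1 b - edge 2 3 + edge 1 3) *~ (-1) ^+ (2 + b).
Proof.
move=> /andP[b4 bn].
have [i Ea] : exists i : 'I_n, 2%N = i.+1 by apply: ex_ord; lia.
have [j Eb] : exists j : 'I_n, b = j.+1 by apply: ex_ord; lia.
have [] := @ab_tableau_col1 i j i 0%N 2%N
  [seq x <- iota 3 (n - 3) | x \notin [:: val i; val j]].
  have -> : iota 0 n = [:: 0, 1, 2 & iota 3 (n - 3)]%N.
    by have {1}-> : n = (n - 3).+3 by lia.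
  have : (val i == 1)%N && (3 <= val j)%N by rewrite /=; lia.
  by move: (val i) (val j) => [|[|x]] [|[|[|y]]].
move=> E1 E2; have := @br_rho_edge i j _ _ _ erefl erefl.
by rewrite E1 E2 -Ea -Eb; apply; lia.
Qed.

Lemma polytabloid_edge t : is_tableau t -> exists a b (c : bool),
  [/\ (1 <= a < b)%N, (b <= n)%N & polytabloid t = edge a b *~ (-1) ^+ c].
Proof.
move=> tP; have [s ->] := tact_trans tableau12P tP.
rewrite (polytabloid_altsum tableau12P).
have : #|s @: second_col t12| = 2%N.
  rewrite card_imset; last exact: perm_inj.
  by rewrite second_col_ab cards2.
move/eqP/cards2P => [i [j [ij ->]]].
have [ltij|leji] := ltnP i j.
  exists i.+1, j.+1, (~~ odd_perm s); split=> //.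
  by rewrite edge_ord signrN mulrNz mulNrz opprK.
exists j.+1, i.+1, (~~ odd_perm s); split=> //.
  by move: ij; rewrite -val_eqE /=; lia.
by rewrite edgeC edge_ord signrN mulrNz mulNrz opprK.
Qed.

Lemma card_pair_cap (i j : 'I_n) X : i != j ->
  #|[set i; j] :&: X| = ((i \in X) + (j \in X))%N.
Proof.
move=> ij; rewrite -sum1_card (eq_bigl (fun k => (k \in [set i; j]) && (k \in X))).
  by rewrite big_mkcondr big_setU1 ?inE //= big_set1; do !case: ifP.
by move=> k; rewrite in_setI.
Qed.

Lemma edge_form a b c d : (1 <= a <= n)%N -> (1 <= b <= n)%N -> a != b ->
  (1 <= c <= n)%N -> (1 <= d <= n)%N -> c != d ->
  spform (edge a b) (edge c d) = (2 * (n - 4)`!)%:R *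
    (((n - 1) * (n - 2))%:R * ((a == c) && (b == d) || (a == d) && (b == c))%:R
     - (n - 1)%:R * ((a == c) + (a == d) + (b == c) + (b == d))%:R + 2%:R).
Proof.
move=> /ex_ord[i ->] /ex_ord[j ->]; rewrite eqSS => ij.
move=> /ex_ord[k ->] /ex_ord[l ->]; rewrite !eqSS => kl.
rewrite !edge_ord Defs.formNl spformC Defs.formNl spformC opprK.
rewrite (gram_altsum tableau12P) ?cards2 ?ij ?kl //.
rewrite card_pair_cap // eqEcard subUset !sub1set !cards2 ij kl andbT !inE.
rewrite -!val_eqE /= in ij kl *; by rewrite !(eq_pairE ij kl).
Qed.

End Edges.

(** * Linear relations between the edges *)

Section EdgeRelations.
Variables (Q : zmodType) (n : nat) (e : nat -> nat -> Q).
Hypothesis eC : forall a b, e a b = e b a.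
Hypothesis star : forall a, (1 <= a <= n)%N ->
  \sum_(1 <= b < n.+1 | b != a) e a b = 0.
Hypothesis total : \sum_(1 <= b < n.+1) \sum_(1 <= a < b) e a b = 0.

(** [Q] will be M^lambda modulo the span of the y_j, so that generation becomes vanishing. The total
    minus the star at 1 leaves only [e 2 3]; after that the star at [b] leaves only [e 1 b]. *)
Lemma edges_vanish_of_y : (3 <= n)%N ->
  (forall a b, (2 <= a < b)%N -> (b <= n)%N -> (a, b) != (2, 3)%N -> e a b = 0) ->
  forall a b, (1 <= a < b)%N -> (b <= n)%N -> e a b = 0.
Proof.
move=> n3 e0.
have e23 : e 2 3 = 0.
  move: total; rewrite big_ltn; last by lia.
  rewrite [X in X + _]big_geq // add0r.
  have E b : (2 <= b < n.+1)%N -> \sum_(1 <= a < b) e a b = e 1 b + e 2 3 *+ (b == 3).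
    move=> /andP[b2 bn]; rewrite big_ltn; last by lia.
    congr (_ + _); case: eqP => [->|b3]; first by rewrite big_nat1.
    rewrite big_nat_cond big1 // => a; rewrite andbT => /andP[a2 ab].
    by apply: e0; rewrite ?a2 // xpair_eqE; apply/negP; lia.
  rewrite (eq_big_nat _ _ E) big_split /=.
  have -> : \sum_(2 <= b < n.+1) e 1 b = 0.
    have /star : (1 <= 1 <= n)%N by lia.
    rewrite big_ltn_cond; last by lia.
    rewrite eqxx /= big_nat_cond => S1; rewrite -[RHS]S1.
    rewrite [LHS]big_nat_cond; by apply: eq_bigl => b; rewrite andbT; lia.
  rewrite add0r.
  rewrite (bigD1_seq 3%N) ?mem_index_iota ?iota_uniq //=.
  by rewrite big1 ?addr0 // => b /negPf ->.
have e0' a b : (2 <= a < b)%N -> (b <= n)%N -> e a b = 0.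
  by move=> ab bn; have [[-> ->]|] := eqVneq (a, b) (2, 3)%N; auto.
move=> [|[|a]] b // ab bn; last exact: e0'.
have := star (a := b); rewrite big_ltn_cond; last by lia.
have -> : (1 != b)%N by lia.
rewrite big_nat_cond big1 => [|c /andP[/andP[c2 cn] cb]]; last first.
  have [bc|bc] := ltnP b c; first by apply: e0' => //; lia.
  by rewrite eC; apply: e0' => //; lia.
by rewrite addr0 eC; apply; lia.
Qed.

End EdgeRelations.

Section Combinations.
Variables (Q : zmodType) (f h p : Q).

(** Integer coordinates with respect to [f], [h], [p]: consequences of linear relations become
    integer identities for [ring] and [lia]. *)
Definition comb3 (a b c : int) : Q := f *~ a + h *~ b + p *~ c.

Lemma comb3D a b c a' b' c' :
  comb3 a b c + comb3 a' b' c' = comb3 (a + a') (b + b') (c + c').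
Proof. by rewrite /comb3 !mulrzDr addrACA [X in X + _ = _]addrACA. Qed.

Lemma comb3N a b c : - comb3 a b c = comb3 (- a) (- b) (- c).
Proof. by rewrite /comb3 !mulrNz !opprD. Qed.

Lemma comb3Mz a b c k :
  comb3 a b c *~ k = comb3 (a * k) (b * k) (c * k).
Proof. by rewrite /comb3 !mulrzDl -!mulrzA. Qed.

Lemma comb3f : f = comb3 1 0 0.
Proof. by rewrite /comb3 mulr1z !mulr0z !addr0. Qed.

Lemma comb3h : h = comb3 0 1 0.
Proof. by rewrite /comb3 mulr1z !mulr0z addr0 add0r. Qed.

Lemma comb3p : p = comb3 0 0 1.
Proof. by rewrite /comb3 mulr1z !mulr0z !add0r. Qed.

End Combinations.

(** Here [m] is n - 3, [q] and [q'] are the edges from 3 and from n - 1 to n, and [g] is the edge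
    {3, 4}, which for n = 6 ends at n - 2 and so belongs to the class of [h]. The three relations
    come from the total sum, from x_1 and from x_{(n-2)+1}. *)
Lemma collapsed_relations (Q : zmodType) (m : nat) (f h p q q' g : Q) :
  (3 <= m)%N -> q = - (f *+ m.-1 + h + p) -> q' = - (p *+ m.+1) ->
  g = (if (3 < m)%N then f else h) ->
  \sum_(1 <= b < m.+1) f *+ b.-1 + h *+ m + p *+ m.+1 = 0 ->
  (if odd m then q + g *+ m.+1./2 else g) = 0 ->
  (let z := p - p - h + f in let w := q + q' + p *+ m in
   if odd m then z + w else z *+ m./2 + w *+ m.+2./2) = 0 ->
  [/\ f = 0, h = 0 & p = 0].
Proof.
move=> m3 -> -> ->.
have sum0 : f = 0 -> \sum_(1 <= b < m.+1) f *+ b.-1 = 0.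
  by move=> ->; rewrite big1 // => b _; rewrite mul0rn.
have sum3 : m = 3%N -> \sum_(1 <= b < m.+1) f *+ b.-1 = f *+ 3.
  by move=> ->; do 3!rewrite big_ltn //; rewrite big_geq //= addr0 mulr0n add0r -mulrS.
(* An opaque copy of [comb3 f h p]; otherwise rewriting [f], [h], [p] would also hit its own
   parameters. *)
have [c [cf ch cp [cD cN cM]]] : exists c : int -> int -> int -> Q,
  [/\ f = c 1 0 0, h = c 0 1 0, p = c 0 0 1 &
  [/\ forall a b d a' b' d', c a b d + c a' b' d' = c (a + a') (b + b') (d + d'),
     forall a b d, - c a b d = c (- a) (- b) (- d) &
     forall a b d k, c a b d *~ k = c (a * k) (b * k) (d * k)]].
  exists (comb3 f h p); split; [exact: comb3f|exact: comb3h|exact: comb3p|].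
  by split=> *; rewrite ?comb3D ?comb3N ?comb3Mz.
move: sum0 sum3; rewrite cf ch cp => sum0 sum3 T; cbv zeta.
have [r [mE r1]] : exists r, m = (odd m + r.*2)%N /\ (1 <= r)%N.
  by exists m./2; rewrite odd_double_half; split=> //; lia.
case: (odd m) mE => /= mE X1 X2; last first.
  have m4 : (3 < m)%N by lia.
  rewrite m4 in X1; move: T; rewrite sum0 // add0r => T.
  have T' : c 0 (2 * r%:Z) (2 * r%:Z + 1) = 0.
    by rewrite -[RHS]T !pmulrn !cM !cD; congr c; lia.
  have X2' : c 0 (2 * r%:Z + 1) (2 * r%:Z + 2) = 0.
    have e2 : m./2 = r by lia.
    rewrite -[RHS]oppr0 -[in RHS]X2 e2 !pmulrn !(cN, cD, cM).
    (* The coefficient of [f] in [X2], cleared with [X1], which says that [f] vanishes. *)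
    pose a := r%:Z - (2 * r%:Z - 1) * (r%:Z + 1).
    rewrite -[LHS]addr0 -[X in _ + X](mul0rz _ (- a)) -X1 cM cD /a.
    by congr c; lia.
  (* The rows (2r, 2r+1) and (2r+1, 2r+2) in [h], [p] have determinant -1; the multipliers below
     invert them. *)
  split=> //.
    rewrite -[RHS](_ : c 0 (2 * r%:Z + 1) (2 * r%:Z + 2) *~ (2 * r%:Z + 1)
      - c 0 (2 * r%:Z) (2 * r%:Z + 1) *~ (2 * r%:Z + 2) = 0).
      by rewrite !(cN, cD, cM); congr c; ring.
    by rewrite T' X2' !mul0rz subr0.
  rewrite -[RHS](_ : c 0 (2 * r%:Z) (2 * r%:Z + 1) *~ (2 * r%:Z + 1)
      - c 0 (2 * r%:Z + 1) (2 * r%:Z + 2) *~ (2 * r%:Z) = 0).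
    by rewrite !(cN, cD, cM); congr c; ring.
  by rewrite T' X2' !mul0rz subr0.
have e1 : uphalf m = r.+1 by lia.
have X2' : c (1 - 2 * r%:Z) (- 2) (- 2) = 0.
  by rewrite -[RHS]X2 !pmulrn !(cN, cD, cM); congr c; lia.
have [m4|m3'] := ltnP 3 m.
  rewrite m4 in X1.
  have X1' : c (1 - r%:Z) (- 1) (- 1) = 0.
    by rewrite -[RHS]X1 e1 !pmulrn !(cN, cD, cM); congr c; lia.
  (* Twice the relation of x_1 minus that of x_{(n-2)+1} leaves exactly [f]. *)
  have f0 : c 1 0 0 = 0.
    rewrite -[RHS](_ : c (1 - r%:Z) (- 1) (- 1) *~ 2 - c (1 - 2 * r%:Z) (- 2) (- 2) = 0).
      by rewrite !(cN, cD, cM); congr c; ring.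
    by rewrite X1' X2' !mul0rz subr0.
  move: T; rewrite sum0 // add0r => T.
  have T' : c 0 (2 * r%:Z + 1) (2 * r%:Z + 2) = 0.
    by rewrite -[RHS]T !pmulrn !cM !cD; congr c; lia.
  have X1'' : c 0 1 1 = 0.
    rewrite -[RHS](_ : c 1 0 0 *~ (1 - r%:Z) - c (1 - r%:Z) (- 1) (- 1) = 0).
      by rewrite !(cN, cD, cM); congr c; ring.
    by rewrite X1' f0 !mul0rz subr0.
  split=> //.
    rewrite -[RHS](_ : c 0 1 1 *~ (2 * r%:Z + 2)
      - c 0 (2 * r%:Z + 1) (2 * r%:Z + 2) = 0).
      by rewrite !(cN, cD, cM); congr c; ring.
    by rewrite X1'' T' !mul0rz subr0.
  rewrite -[RHS](_ : c 0 (2 * r%:Z + 1) (2 * r%:Z + 2)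
      - c 0 1 1 *~ (2 * r%:Z + 1) = 0).
    by rewrite !(cN, cD, cM); congr c; ring.
  by rewrite X1'' T' !mul0rz subr0.
(* For n = 6 the multipliers below are the rows of the inverse of the matrix with rows (-2, 1, -1),
   (-1, -2, -2), (3, 3, 4). *)
have r1' : r = 1%N by lia.
have m3E : m = 3%N by lia.
rewrite ltnNge m3' e1 r1' /= in X1; rewrite r1' in X2'.
have X1' : c (- 2) 1 (- 1) = 0.
  by rewrite -[RHS]X1 m3E !pmulrn !(cN, cD, cM); congr c.
have T' : c 3 3 4 = 0.
  by rewrite -[RHS]T sum3 // m3E !pmulrn !(cN, cD, cM); congr c.
split.
- rewrite -[RHS](_ : c (- 2) 1 (- 1) *~ 2
    + c (1 - 2 * 1%N%:Z) (- 2) (- 2) *~ 7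
    + c 3 3 4 *~ 4 = 0).
    by rewrite !(cN, cD, cM); congr c.
  by rewrite X1' X2' T' !mul0rz !addr0.
- rewrite -[RHS](_ : c (- 2) 1 (- 1) *~ 2
    + c (1 - 2 * 1%N%:Z) (- 2) (- 2) *~ 5
    + c 3 3 4 *~ 3 = 0).
    by rewrite !(cN, cD, cM); congr c.
  by rewrite X1' X2' T' !mul0rz !addr0.
rewrite -[RHS](_ : c (- 2) 1 (- 1) *~ (- 3)
    + c (1 - 2 * 1%N%:Z) (- 2) (- 2) *~ (- 9)
    + c 3 3 4 *~ (- 5) = 0).
  by rewrite !(cN, cD, cM); congr c.
by rewrite X1' X2' T' !mul0rz !addr0.
Qed.

(* [n = m + 3]; the generators collapse to [f = e 1 2], [h = e 1 (n - 2)] and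
   [p = e 1 (n - 1)], on which the remaining three relations have determinant
   [1] or [-1]. *)
Lemma edges_vanish_of_x (Q : zmodType) (m : nat) (n := m.+3) (e : nat -> nat -> Q) :
  (3 <= m)%N ->
  (forall a b, e a b = e b a) ->
  (forall a, (1 <= a <= n)%N -> \sum_(1 <= b < n.+1 | b != a) e a b = 0) ->
  \sum_(1 <= b < n.+1) \sum_(1 <= a < b) e a b = 0 ->
  (forall k, (2 <= k <= m.+1)%N -> e 1 m.+2 = e k m.+2) ->
  (forall b c, (3 <= b < c)%N -> (c <= m.+2)%N -> (b, c) != (m.+1, m.+2) ->
    e b c - e 1 c - e b 2 + e 1 2 = 0) ->
  (forall c, (4 <= c <= m.+2)%N -> e 2 c - e 1 c - e 2 3 + e 1 3 = 0) ->
  (if odd n then e 3 4 else e 3 n + e 3 4 *+ (n - 2)./2) = 0 ->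
  (let z := e m.+1 m.+2 - e 1 m.+2 - e m.+1 2 + e 1 2 in
   let w := e 3 n + e m.+2 n + e 3 m.+2 *+ m in
   if odd n then z *+ m./2 + w *+ (m.+2)./2 else z + w) = 0 ->
  forall a b, (1 <= a < b)%N -> (b <= n)%N -> e a b = 0.
Proof.
move=> m3 eC star total hp cyc cyc2 rel1 rel2.
set f := e 1 2; set h := e 1 m.+1; set p := e 1 m.+2.
(* By x_2, ..., x_{n-2} all edges to n - 1, except the one from n, agree. *)
have ep k : (1 <= k <= m.+1)%N -> e k m.+2 = p.
  by case: k => [|[|k]] // k1; rewrite -hp.
(* In a 4-cycle relation with c = n - 1 the two edges to n - 1 cancel; this gives the edges to 2. *)
have e23 : e 2 3 = e 1 3.
  have : (4 <= m.+2 <= m.+2)%N by lia.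
  move/cyc2; rewrite ep; last by lia.
  by rewrite subrr add0r addrC => /eqP; rewrite subr_eq0 => /eqP.
have ek2 k : (3 <= k <= m)%N -> e k 2 = f.
  move=> k3; have := cyc k m.+2; rewrite ep; last by lia.
  rewrite subrr add0r xpair_eqE addrC => E; apply/esym/eqP; rewrite -subr_eq0 E //; lia.
have e13 : e 1 3 = f by rewrite -e23 eC ek2 //; lia.
have e2c c : (4 <= c <= m.+1)%N -> e 2 c = e 1 c.
  move=> c4; have := cyc2 c; rewrite e23 => E.
  by apply/eqP; rewrite -subr_eq0; move: E; rewrite subrK => -> //; lia.
(* The remaining 4-cycles now say that an edge inside [1, n - 2] depends only on its larger end. *)
have ebc b c : (1 <= b < c)%N -> (c <= m.+1)%N -> e b c = e 1 c.
  case: b => [|[|[|b]]] // bc cm.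
    by have [->|c3] := eqVneq c 3%N; rewrite // e2c //; lia.
  have := cyc b.+3 c; rewrite ek2; last by lia.
  rewrite subrK xpair_eqE => E; apply/eqP; rewrite -subr_eq0 E //; lia.
have ef b c : (1 <= b < c)%N -> (c <= m)%N -> e b c = f.
  move=> bc cm; rewrite ebc //; last by lia.
  case: c bc cm => [|[|[|[|c]]]] //; try lia.
  by move=> _ cm; rewrite -e2c; [rewrite eC; apply: ek2|]; lia.
have eh b : (1 <= b <= m)%N -> e b m.+1 = h by move=> bm; apply: ebc; lia.
have tri : \sum_(1 <= b < m.+1) \sum_(1 <= a < b) e a b
    = \sum_(1 <= b < m.+1) f *+ b.-1.
  apply: eq_big_nat => b /andP[b1 bm]; rewrite (@eq_big_nat _ _ _ _ _ _ (fun=> f)).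
    by rewrite sumr_const_nat subn1.
  by move=> a ab; apply: ef => //; lia.
have sum_ne b : (1 <= b <= n)%N -> \sum_(1 <= a < n.+1 | a != b) e b a
  = \sum_(1 <= a < b) e b a + \sum_(b.+1 <= a < n.+1) e b a.
  move=> bn; rewrite (@big_cat_nat _ _ _ b) /=; [|lia|lia]; congr (_ + _).
    by rewrite big_nat_cond [RHS]big_nat_cond; apply: eq_bigl => a; lia.
  rewrite big_ltn_cond; last by lia.
  rewrite eqxx big_nat_cond [RHS]big_nat_cond; apply: eq_bigl => a; lia.
(* The edges to n are controlled by stars: the star at n gives their sum, the other stars their
   values. *)
have q_last : \sum_(1 <= a < n) e a n = 0.
  have nn : (1 <= n <= n)%N by rewrite leqnn.
  rewrite -[RHS](star n nn) sum_ne // [X in _ = _ + X]big_geq // addr0.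
  by apply: eq_bigr => a _; rewrite eC.
have q_low k : (1 <= k <= m)%N -> e k n = - (f *+ m.-1 + h + p).
  move=> km; have : (1 <= k <= n)%N by lia.
  move=> kn; have := star k kn; rewrite sum_ne //.
  rewrite /n big_nat_recr /=; last by lia.
  rewrite big_nat_recr /=; last by lia.
  rewrite big_nat_recr /=; last by lia.
  rewrite (@eq_big_nat _ _ _ 1%N k _ (fun=> f)); last first.
    by move=> a ak; rewrite eC; apply: ef; lia.
  rewrite (@eq_big_nat _ _ _ k.+1 m.+1 _ (fun=> f)); last first.
    by move=> a ak; apply: ef; lia.
  rewrite !sumr_const_nat eh // ep; last by lia.
  have -> : m.-1 = ((k - 1) + (m.+1 - k.+1))%N by lia.
  move=> E; apply/eqP; rewrite -addr_eq0 addrC mulrnDr -[X in _ == X]E.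
  by rewrite !addrA.
have q'_p : e m.+2 n = - (p *+ m.+1).
  have nn : (1 <= m.+2 <= n)%N by rewrite /n; lia.
  have := star _ nn; rewrite sum_ne // big_nat1.
  rewrite (@eq_big_nat _ _ _ 1%N _ _ (fun=> p)); last first.
    by move=> a ak; rewrite eC; apply: ep; lia.
  rewrite sumr_const_nat subn1 /= => E; apply/eqP.
  by rewrite -addr_eq0 addrC E.
have q'_h : e m.+1 n = - (h *+ m + p).
  have nn : (1 <= m.+1 <= n)%N by rewrite /n; lia.
  have := star _ nn; rewrite sum_ne // [X in _ + X]big_nat_recr //=.
  rewrite big_nat1 ep; last by lia.
  rewrite (@eq_big_nat _ _ _ 1%N _ _ (fun=> h)); last first.
    by move=> a ak; rewrite eC; apply: eh; lia.
  rewrite sumr_const_nat subn1 /= => E; apply/eqP.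
  by rewrite -addr_eq0 addrC -addrA E.
have tot : \sum_(1 <= b < m.+1) f *+ b.-1 + h *+ m + p *+ m.+1 = 0.
  have Sh : \sum_(1 <= a < m.+1) e a m.+1 = h *+ m.
    have -> : \sum_(1 <= a < m.+1) e a m.+1 = \sum_(1 <= a < m.+1) h.
      by apply: eq_big_nat => a ak; apply: eh; lia.
    by rewrite sumr_const_nat subn1.
  have Sp : \sum_(1 <= a < m.+2) e a m.+2 = p *+ m.+1.
    have -> : \sum_(1 <= a < m.+2) e a m.+2 = \sum_(1 <= a < m.+2) p.
      by apply: eq_big_nat => a ak; apply: ep; lia.
    by rewrite sumr_const_nat subn1.
  have := total; rewrite /n big_nat_recr //= big_nat_recr //= big_nat_recr //=.
  by rewrite q_last addr0 tri Sh Sp.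
suff [f0 h0 p0] : [/\ f = 0, h = 0 & p = 0].
  move=> a b ab bn; have [bm|bm] := leqP b m; first by rewrite ef.
  have [E|b1] := eqVneq b m.+1; first by rewrite E eh; [exact: h0|lia].
  have [E|b2] := eqVneq b m.+2; first by rewrite E ep; [exact: p0|lia].
  have E : b = n by rewrite /n; lia.
  rewrite E in ab *.
  have [am|am] := leqP a m; first by rewrite q_low;
    [rewrite f0 h0 p0 mul0rn !addr0 oppr0|lia].
  have [->|a1] := eqVneq a m.+1; first by rewrite q'_h h0 p0 mul0rn addr0 oppr0.
  have -> : a = m.+2 by rewrite /n in ab; lia.
  by rewrite q'_p p0 mul0rn oppr0.
have odd_n : odd n = ~~ odd m by rewrite /n /= negbK.
apply: (@collapsed_relations _ m f h p (e 3 n) (e m.+2 n) (e 3 4)) => //.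
- by apply: q_low; lia.
- by case: ltnP => m4; [apply: ef; lia|rewrite -(eh 3) //; congr (e _ _); lia].
- move: rel1; rewrite odd_n if_neg.
  by have -> : (n - 2 = m.+1)%N by rewrite /n; lia.
move: rel2; cbv zeta; rewrite odd_n if_neg (ep m.+1) ?(ep 3) -/p; try lia.
by rewrite (eC m.+1 2) e2c // ?(eh 1%N) -/h; try lia.
Qed.

(** * The star relations and the total relation hold for edges *)

Section EdgeSums.
Variable n : nat.
Hypothesis n4 : (4 <= n)%N.
Local Notation edge := (edge n4).

Lemma sum_indicator (a c : nat) : (1 <= c <= n)%N ->
  \sum_(1 <= b < n.+1 | b != a) (b == c)%:R = (c != a)%:R :> int.
Proof.
move=> cn; rewrite big_mkcond (bigD1_seq c) ?mem_index_iota ?iota_uniq //=.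
rewrite eqxx big1 ?addr0 => [|b /negPf ->]; last by case: ifP.
by case: ifP => // /negbFE ->.
Qed.

(** With all-one matrices J of the fitting sizes, B B^T = (n-2) I + J, the columns of B sum to 2 and
    its rows to n-1. So B times the form matrix is a multiple of (n-1)(n-2) B - (n-1)((n-2) B + 2 J)
    + 2(n-1) J = 0. *)
Lemma form_star (a c d : nat) : (1 <= a <= n)%N -> (1 <= c <= n)%N ->
  (1 <= d <= n)%N -> c != d ->
  spform (\sum_(1 <= b < n.+1 | b != a) edge a b) (edge c d) = 0.
Proof.
move=> an cn dn cd; rewrite spform_suml.
pose A : int := ((n - 1) * (n - 2))%:R; pose B : int := (n - 1)%:R.
(* The product of [edge a b] with [edge c d] is affine in the indicators of [b = d] and [b = c];
   these are its coefficients. *)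
pose al : int := A * (a == c)%:R - B; pose be : int := A * (a == d)%:R - B.
pose ga : int := 2%:R - B * ((a == c) + (a == d))%:R.
transitivity (\sum_(1 <= b < n.+1 | b != a) (2 * (n - 4)`!)%:R *
   (al * (b == d)%:R + be * (b == c)%:R + ga)).
  rewrite big_nat_cond [RHS]big_nat_cond; apply: eq_bigr => b /andP[bn ba].
  rewrite edge_form //; last by rewrite eq_sym.
  congr (_ * _).
  have -> : ((a == c) && (b == d) || (a == d) && (b == c))%:R
      = (a == c)%:R * (b == d)%:R + (a == d)%:R * (b == c)%:R :> int.
    have [ac|ac] := eqVneq a c; have [ad|ad] := eqVneq a d => /=.
    - by rewrite -ac ad eqxx in cd.
    - by rewrite orbF mul1r mul0r addr0.
    - by rewrite mul1r mul0r add0r.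
    by rewrite !mul0r addr0.
  by rewrite /ga /al /be !natrD; ring.
have Sga : \sum_(1 <= b < n.+1 | b != a) ga = ga * B.
  have -> : \sum_(1 <= b < n.+1 | b != a) ga
     = \sum_(1 <= b < n.+1) (ga - ga * (b == a)%:R).
    rewrite big_mkcond; apply: eq_bigr => b _.
    by case: eqP => _; rewrite ?mulr1 ?mulr0 ?subrr ?subr0.
  rewrite sumrB -mulr_sumr sumr_const_nat.
  rewrite (bigD1_seq a) ?mem_index_iota ?iota_uniq //= eqxx big1 ?addr0.
    by rewrite subn1 /= -[ga *+ n]mulr_natr /B natrB; [ring|lia].
  by move=> b /negPf ->.
have [alE beE gaE] : [/\ al = A * (a == c)%:R - B, be = A * (a == d)%:R - B
    & ga = 2%:R - B * ((a == c) + (a == d))%:R] by [].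
clearbody al be ga; rewrite -mulr_sumr !big_split /= Sga -[X in X + _ + _]mulr_sumr.
rewrite -[X in _ + X + _]mulr_sumr !sum_indicator //.
have AE : A = B * (B - 1).
  rewrite /A natrM; congr (_ * _); rewrite /B; have -> : (n - 1 = (n - 2) + 1)%N by lia.
  by rewrite natrD addrK.
rewrite gaE alE beE AE (eq_sym d) (eq_sym c).
have [ac|ac] := eqVneq a c; have [ad|ad] := eqVneq a d => /=.
- by rewrite -ac ad eqxx in cd.
- by ring.
- by ring.
by ring.
Qed.

(** The star is orthogonal to each of its own terms, hence has norm zero. *)
Lemma edge_star (a : nat) : (1 <= a <= n)%N ->
  \sum_(1 <= b < n.+1 | b != a) edge a b = 0.
Proof.
move=> an; apply: spform_eq0; rewrite spform_sumr big_nat_cond big1 // => b.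
by case/andP=> bn ba; rewrite form_star // eq_sym.
Qed.

(* Summing over all stars counts every edge twice. *)
Lemma edge_total : \sum_(1 <= b < n.+1) \sum_(1 <= a < b) edge a b = 0.
Proof.
set T := LHS.
have T2 : T + T = 0.
  transitivity (\sum_(1 <= b < n.+1) \sum_(1 <= a < n.+1 | a != b) edge b a).
    have E : T = \sum_(1 <= b < n.+1) \sum_(1 <= a < n.+1 | (a < b)%N) edge b a.
      rewrite /T !big_nat; apply: eq_bigr => b /andP[b1 bn].
      rewrite (@big_nat_widen _ _ _ 1%N b n.+1) 1?ltnW //.
      by rewrite big_mkcond [RHS]big_mkcond; apply: eq_bigr => a _; rewrite edgeC.
    have E' : T = \sum_(1 <= b < n.+1) \sum_(1 <= a < n.+1 | (b < a)%N) edge b a.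
      rewrite E (exchange_big_dep xpredT) //=; apply: eq_bigr => b _.
      by apply: eq_bigr => a _; rewrite edgeC.
    rewrite {1}E E' -big_split; apply: eq_bigr => b _ /=.
    rewrite big_mkcond [X in _ + X]big_mkcond [RHS]big_mkcond -big_split.
    by apply: eq_bigr => a _; case: ltngtP; rewrite /= ?addr0 ?add0r.
  by rewrite big_nat big1 // => b bn; apply: edge_star.
apply: spform_eq0; have := spformDr T T T; rewrite T2 spformC spform0l => /esym/eqP.
by rewrite -mulr2n mulrn_eq0 => /eqP.
Qed.

End EdgeSums.

(** * The Gram matrix *)

Definition revlex (p q : nat * nat) : bool :=
  (q.2 < p.2)%N || (q.2 == p.2) && (q.1 < p.1)%N.

Lemma pairwise_revlex (s t : seq nat) :
  pairwise (fun a b => b < a)%N s -> pairwise (fun a b => b < a)%N t ->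
  pairwise revlex [seq (b, c) | c <- s, b <- t].
Proof.
move=> + t_dec; elim: s => //= c s IH /andP[c_gt /IH s_dec].
rewrite pairwise_cat s_dec andbT; apply/andP; split.
  apply/allrelP => p q /mapP[b _ ->] /allpairsP[[c' b'] /= [c's _ ->]].
  by rewrite /revlex /=; move/allP: c_gt => /(_ _ c's) ->.
rewrite pairwise_map; apply: sub_pairwise t_dec => b b' /= bb'.
by rewrite /revlex /= eqxx bb' orbT.
Qed.

Lemma rev_iota_dec m k : pairwise (fun a b => b < a)%N (rev (iota m k)).
Proof.
rewrite -sorted_pairwise => [|x y z xy yz]; last exact: ltn_trans yz xy.
by rewrite rev_sorted iota_ltn_sorted.
Qed.

Section YPairs.
Variable n : nat.
Hypothesis n6 : (6 <= n)%N.

(** A single enumeration of the pairs in [2, n] other than (2, 3). It follows [revlex] across all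
    three blocks of the y_i, and this order makes the matrix triangular. *)
Definition ypair (i : nat) : nat * nat :=
  if (i <= n - 2)%N then (n - i, n)%N
  else if (i <= 2 * n - 5)%N then (n - 1 - (i - (n - 2)), n - 1)%N
  else nth (0, 0)%N (bc_pairs n) (i - (2 * n - 5)).-1.

Lemma yvec_ypair i : yvec n i = br n (ypair i).1 (ypair i).2.
Proof. by rewrite /yvec /ypair; do !case: ifP. Qed.

Lemma mem_bc_pairs b c : ((b, c) \in bc_pairs n) =
  [&& (2 <= b)%N, (b < c)%N, (c <= n - 2)%N & (b, c) != (2, 3)%N].
Proof.
rewrite mem_filter; apply/andP/and4P => [[/andP[bc ne] /allpairsP[[c' b'] /= [+ + E]]]|].
  case: E => <- <-; rewrite !mem_rev !mem_iota => /andP[c2 cn] /andP[b2 bn].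
  by split=> //; lia.
move=> [b2 bc cn ne]; split; first exact/andP.
by apply: allpairs_f; rewrite mem_rev mem_iota; lia.
Qed.

Lemma pairwise_bc_pairs : pairwise revlex (bc_pairs n).
Proof. by apply: pairwise_filter; apply: pairwise_revlex; exact: rev_iota_dec. Qed.

(** Each [c] has c - 2 partners in [2, c - 1]; summing over [c] counts the 2-subsets of [2, n - 2],
    from which (2, 3) is removed. *)
Lemma size_bc_pairs : size (bc_pairs n) = ('C(n - 3, 2) - 1)%N.
Proof.
set N := (n - 3)%N; set s := rev (iota 2 N).
pose L := [seq p <- [seq (b, c) | c <- s, b <- s] | (p.1 < p.2)%N].
have sizeL : size L = 'C(N, 2).
  rewrite size_filter count_flatten -map_comp /= -bin2_sum.
  set F := (F in map F s); have FE : {in s, F =1 fun c => (c - 2)%N}.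
    move=> c; rewrite mem_rev mem_iota => cN; rewrite /F /= count_map count_rev.
    have -> : N = ((c - 2) + (N - (c - 2)))%N by lia.
    rewrite iotaD count_cat (_ : 2 + (c - 2) = c)%N; last by lia.
    rewrite (eq_in_count (a2 := predT)) => [|b]; last by rewrite mem_iota /=; lia.
    rewrite count_predT size_iota [X in (_ + X)%N](_ : _ = 0%N) ?addn0 //.
    apply/eqP; rewrite -leqn0 leqNgt -has_count; apply/hasPn => b.
    by rewrite mem_iota /=; lia.
  rewrite ((eq_in_map _ _ _).1 FE) sumnE big_map /s.
  rewrite (perm_big (iota 2 N)) /=; last by rewrite perm_rev.
  have -> : iota 2 N = index_iota 2 N.+2 by rewrite /index_iota subn2.
  rewrite (big_addn 0 _ 2).
  by rewrite subn2 /=; apply: eq_bigr => i _; rewrite addnK.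
have uL : uniq L.
  apply: (@pairwise_uniq _ revlex) => [p|]; first by rewrite /revlex !ltnn andbF.
  by apply: pairwise_filter; apply: pairwise_revlex; exact: rev_iota_dec.
have mL : (2, 3)%N \in L.
  by rewrite mem_filter /=; apply: allpairs_f; rewrite mem_rev mem_iota; lia.
rewrite -sizeL subn1 -(size_rem mL) rem_filter // /L -filter_predI.
by congr (size _); apply: eq_filter => p; rewrite /= andbC.
Qed.

Lemma ypair_bc i : (2 * n - 4 <= i <= nvec n)%N ->
  exists2 k, ypair i = nth (0, 0)%N (bc_pairs n) k
    & (k < size (bc_pairs n))%N && (i == k + (2 * n - 4))%N.
Proof.
rewrite size_bc_pairs /nvec /ypair => /andP[i_gt i_le].
have [-> ->] : (i <= n - 2)%N = false /\ (i <= 2 * n - 5)%N = false by lia.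
by exists (i - (2 * n - 5)).-1 => //; lia.
Qed.

Lemma ypair_mem i : (1 <= i <= nvec n)%N ->
  [/\ (2 <= (ypair i).1)%N, ((ypair i).1 < (ypair i).2)%N, ((ypair i).2 <= n)%N
    & ypair i != (2, 3)%N].
Proof.
move=> /andP[i1 im]; have [bc|bc] := leqP (2 * n - 4) i.
  have [|k -> /andP[kb _]] := ypair_bc (i := i); first by rewrite bc.
  have := mem_nth (0, 0)%N kb; case: (nth _ _ _) => b c.
  by rewrite mem_bc_pairs => /and4P[? ? ? ?]; split=> //=; lia.
rewrite /ypair; case: ifP => i2 /=; last (case: ifP => i3; last by lia).
  by split; rewrite ?xpair_eqE; lia.
by rewrite /=; split; rewrite ?xpair_eqE; lia.
Qed.

Lemma ypair_bc_mem i : (2 * n - 4 <= i <= nvec n)%N -> ((ypair i).2 <= n - 2)%N.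
Proof.
move=> /ypair_bc[k -> /andP[kb _]].
have := mem_nth (0, 0)%N kb; case: (nth _ _ _) => b c.
by rewrite mem_bc_pairs => /and4P[].
Qed.

Lemma ypair_revlex i j : (1 <= i < j)%N -> (j <= nvec n)%N ->
  revlex (ypair i) (ypair j).
Proof.
move=> /andP[i1 ij] jm; have [bcj|bcj] := leqP (2 * n - 4) j; last first.
  rewrite /ypair /revlex.
  have [i2|i2] := leqP i (n - 2); have [j2|j2] := leqP j (n - 2); try by lia.
  - by rewrite /=; lia.
  - by have -> : (j <= 2 * n - 5)%N by [lia]; rewrite /=; lia.
  by have [-> ->] : (j <= 2 * n - 5)%N /\ (i <= 2 * n - 5)%N by [lia]; rewrite /=; lia.
have [bci|bci] := leqP (2 * n - 4) i; last first.
  have := @ypair_bc_mem j; rewrite bcj jm /revlex => /(_ isT) jn.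
  rewrite [ypair i]/ypair; case: ifP => i2 /=; first by lia.
  by have -> : (i <= 2 * n - 5)%N by [lia]; rewrite /=; lia.
have [|k -> /andP[kb /eqP ki]] := @ypair_bc i; first by lia.
have [|l -> /andP[lb /eqP lj]] := @ypair_bc j; first by lia.
by apply: (pairwiseP _ pairwise_bc_pairs); rewrite ?inE //; lia.
Qed.

Lemma ypair_onto a b : (2 <= a < b)%N -> (b <= n)%N -> (a, b) != (2, 3)%N ->
  exists2 i, (1 <= i <= nvec n)%N & ypair i = (a, b).
Proof.
move=> /andP[a2 ab] bn ne; have szE := size_bc_pairs.
have [b2|b2] := leqP b (n - 2).
  have mem : (a, b) \in bc_pairs n by rewrite mem_bc_pairs a2 ab b2 ne.
  have := mem; rewrite -index_mem szE => k_lt.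
  exists (index (a, b) (bc_pairs n) + (2 * n - 4))%N.
    by rewrite /nvec; lia.
  rewrite /ypair; do 2 (rewrite ifF; last by lia).
  by rewrite (_ : _.-1 = index (a, b) (bc_pairs n)) ?nth_index //; lia.
have [bE|b1] := eqVneq b n.
  exists (n - a)%N; first by rewrite /nvec; lia.
  by rewrite /ypair ifT; [congr (_, _)|]; lia.
exists (n - 2 + (n - 1 - a))%N; first by rewrite /nvec; lia.
rewrite /ypair ifF; last by lia.
by rewrite ifT; [congr (_, _)|]; lia.
Qed.

End YPairs.

(** * The vectors x_i in terms of edges *)

Lemma eq_sign (a b : nat) : odd a = odd b -> (-1) ^+ a = (-1) ^+ b :> int.
Proof. by move=> ab; rewrite -signr_odd ab signr_odd. Qed.

Section Vectors.
Variable n : nat.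
Hypothesis n6 : (6 <= n)%N.
Let n4 : (4 <= n)%N := ltnW (ltnW n6).
Local Notation edge := (edge n4).

Lemma br_sign a b : (1 <= a < b)%N -> (b <= n)%N ->
  br n a b = if odd (a + b) then - edge a b else edge a b.
Proof.
by move=> ab bn; rewrite (br_edge n4) // -signr_odd; case: odd; rewrite ?expr1.
Qed.

(* An alternating 4-cycle through the vertex 1; it is killed by the incidence
   matrix and by [J], so the form acts on it as a scalar. *)
Definition cyc (b c : nat) : permmod n (lam22 n) :=
  let d := if b == 2%N then 3%N else 2%N in
  edge b c - edge 1 c - edge b d + edge 1 d.

Lemma br_rho_cyc b c : (2 <= b < c)%N -> (c <= n)%N -> (b, c) != (2, 3)%N ->
  br_rho n b c = cyc b c *~ (-1) ^+ (b + c).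
Proof.
rewrite /cyc => bc cn ne; have [E|b2] := eqVneq b 2%N.
  by rewrite E (br_rho_edge13 n4) //; move: ne; rewrite E xpair_eqE /=; lia.
by rewrite (br_rho_edge12 n4) //; lia.
Qed.

(** Up to the common sign (-1)^(n+1), the expression in parentheses in x_{(n-2)+1}. Its coefficients
    sum to n - 1, which makes its products with edges divisible by n - 1. *)
Definition wspart : permmod n (lam22 n) :=
  edge 3 n + edge (n - 1) n + edge 3 (n - 1) *+ (n - 3).

Lemma spart_edge : spart n = if odd n then wspart else - wspart.
Proof.
rewrite /spart !br_sign; try lia.
rewrite -signr_odd.
have -> : odd (3 + n) = ~~ odd n by lia.
have -> : odd (n - 1 + n) = true by lia.
have -> : odd (3 + (n - 1)) = odd n by lia.
rewrite /wspart; case: (odd n); rewrite /= ?expr1 ?expr0 ?mulrN1z ?opprK ?mulr1z.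
  by rewrite mulNrn opprK.
by rewrite !opprD.
Qed.

Lemma xvec_1 : xvec n 1 =
  - (if odd n then edge 3 4 else edge 3 n + edge 3 4 *+ (n - 2)./2).
Proof.
rewrite /xvec /= !br_sign; try lia.
have -> : odd (3 + n) = ~~ odd n by lia.
by case: (odd n) => //=; rewrite opprD mulNrn.
Qed.

Lemma xvec_mid i : (2 <= i <= n - 2)%N -> xvec n i =
  (edge (n - i) (n - 1) - edge 1 (n - 1)) *~ (-1) ^+ (i.+1).
Proof.
move=> /andP[i2 i_le]; rewrite /xvec i_le ifF; last by lia.
rewrite !(br_edge n4); try lia.
rewrite mulrzBl addrC; congr (_ + _).
  by congr (_ *~ _); apply: eq_sign; lia.
rewrite -mulrzA -exprD -mulrNz; congr (_ *~ _).
by rewrite -[RHS]mulN1r -exprS; apply: eq_sign; lia.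
Qed.

Lemma xvec_n1 : xvec n (n - 1) =
  - (if odd n then cyc (n - 2) (n - 1) *+ (n - 3)./2 + wspart *+ (n - 1)./2
     else cyc (n - 2) (n - 1) + wspart).
Proof.
rewrite /xvec ifF; last by lia.
rewrite ifF; last by lia.
rewrite ifT; last by lia.
rewrite spart_edge br_rho_cyc ?xpair_eqE; try lia.
rewrite -signr_odd.
have -> : odd (n - 2 + (n - 1)) = true by lia.
by case: (odd n); rewrite expr1 mulrN1z ?mulNrn [RHS]opprD.
Qed.

Lemma xvec_hi i : (n <= i <= nvec n)%N ->
  xvec n i = cyc (ypair n i).1 (ypair n i).2
    *~ (-1) ^+ ((ypair n i).1 + (ypair n i).2).
Proof.
move=> /andP[i_ge i_le]; have [|b2 bc cn ne] := @ypair_mem n n6 i; first by lia.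
rewrite -br_rho_cyc -?surjective_pairing //; last by rewrite b2 bc.
rewrite /xvec /ypair.
rewrite ifF; last by lia.
rewrite ifF; last by lia.
rewrite ifF; last by lia.
rewrite [in RHS]ifF; last by lia.
by case: ifP.
Qed.

End Vectors.

Section GramValues.
Variable n : nat.
Hypothesis n6 : (6 <= n)%N.
Let n4 : (4 <= n)%N := ltnW (ltnW n6).
Local Notation edge := (edge n4).
Local Notation K0 := (2 * (n - 4)`!)%N.
Local Notation B := ((n - 1)%N%:Z).
Local Notation "[ b ]" := ((nat_of_bool b)%:Z) (at level 0, b at level 99).

Variables p q : nat.
Hypotheses (p2 : (2 <= p)%N) (pq : (p < q)%N) (qn : (q <= n)%N).

Lemma edge_form_lt a b : (1 <= a < b)%N -> (b <= n)%N ->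
  spform (edge a b) (edge p q) = K0%:Z *
    (B * (n - 2)%N%:Z * [(a == p) && (b == q)]
     - B * ([a == p] + [a == q] + [b == p] + [b == q]) + 2%:Z).
Proof.
move=> /andP[a1 ab] bn; by rewrite edge_form; lia.
Qed.

(** Only the scalar part of the form acts on a 4-cycle. Its two edges at 1 are never {p, q}; the
    edge {b, d} is {2, b} for b > 2, and for b = 2 it is the excluded {2, 3}. *)
Lemma form_cyc b c : (2 <= b < c)%N -> (c <= n)%N -> (b, c) != (2, 3)%N ->
  (p, q) != (2, 3)%N ->
  spform (cyc n6 b c) (edge p q) = K0%:Z * (B * (n - 2)%N%:Z) *
    ([(b == p) && (c == q)] - [(p == 2) && (q == b)]).
Proof.
rewrite /cyc !xpair_eqE => /andP[b2 bc] cn ne ne'.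
have p1 : (1 == p) = false by lia.
case: eqVneq => [E|b2'].
  rewrite !(Defs.formDl, Defs.formNl) E !edge_form_lt; [|lia..].
  rewrite p1 /=; have -> : (2 == p) && (3 == q) = false by lia.
  by have -> : (p == 2) && (q == 2) = false by [lia]; rewrite /=; ring.
rewrite (edgeC n4 b 2) !(Defs.formDl, Defs.formNl) !edge_form_lt; [|lia..].
rewrite p1 /= (eq_sym p) (eq_sym q); ring.
Qed.

Lemma form_mid k : (2 <= k <= n - 2)%N ->
  spform (edge k (n - 1) - edge 1 (n - 1)) (edge p q) = K0%:Z * B *
    ((n - 2)%N%:Z * [(k == p) && (n - 1 == q)%N] - [k == p] - [k == q]).
Proof.
move=> /andP[k2 kn]; rewrite Defs.formDl Defs.formNl !edge_form_lt; [|lia..].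
have -> : (1 == p) = false by lia.
have -> : (1 == q) = false by lia.
by rewrite /=; ring.
Qed.

(** Identity part, incidence part and all-one part of the product, divided by 2(n-4)! (n-1). At the
    vertices 3, n, n - 1 the coefficients of [wspart] add up to n - 2, 2, n - 2. *)
Definition wspart_factor : int :=
  (n - 2)%N%:Z * ([(3 == p) && (n == q)] + [(n - 1 == p)%N && (n == q)]
       + (n - 3)%N%:Z * [(3 == p) && (n - 1 == q)%N])
   - ((n - 2)%N%:Z * ([3 == p] + [3 == q]) + 2%:Z * ([n == p] + [n == q])
       + (n - 2)%N%:Z * ([(n - 1)%N == p] + [(n - 1)%N == q])) + 2%:Z.

Lemma form_wspart :
  spform (wspart n6) (edge p q) = K0%:Z * B * wspart_factor.
Proof.
rewrite /wspart /wspart_factor !Defs.formDl pmulrn spformZl !edge_form_lt; [|lia..].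
have -> : (n - 3)%N%:Z = (n - 2)%N%:Z - 1 by lia.
have -> : B = (n - 2)%N%:Z + 1 by lia.
ring.
Qed.

(** Makes [wspart] orthogonal to y_1, ..., y_{n-2}, so it may be added to row n - 1 without spoiling
    triangularity. *)
Lemma wspart_factor0 : q = n -> wspart_factor = 0.
Proof.
rewrite /wspart_factor => qE; rewrite qE eqxx.
have -> : (n - 1 == n)%N = false by lia.
have [-> ->] : (3 == n) = false /\ (n == p) = false by lia.
by rewrite !andbF !andbT /=; ring.
Qed.

(** The 4-cycle contributes n - 2 at the same place. For even n the sum is 2; for odd n the weights
    give (n-3)/2 (n-2) + (n-1)/2 (4-n) = 1, which explains the coefficients of x_{(n-2)+1}. *)
Lemma wspart_factor_diag : (p, q) = (n - 2, n - 1)%N ->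
  wspart_factor = 2 - (n - 2)%N%:Z.
Proof.
rewrite /wspart_factor => -[-> ->]; rewrite !eqxx.
have [-> ->] : (n == n - 1)%N = false /\ (n == n - 2)%N = false by lia.
have [-> ->] : (n - 1 == n - 2)%N = false /\ (3 == n - 1)%N = false by lia.
have -> : (3 == n - 2)%N = false by lia.
by rewrite /=; ring.
Qed.

Lemma form_34 : spform (edge 3 4) (edge p q) = K0%:Z *
  (B * (n - 2)%N%:Z * [(3 == p) && (4 == q)]
     - B * ([3 == p] + [3 == q] + [4 == p] + [4 == q]) + 2%:Z).
Proof. by rewrite edge_form_lt; [|lia..]. Qed.

Lemma form_3n : spform (edge 3 n) (edge p q) = K0%:Z *
  (B * (n - 2)%N%:Z * [(3 == p) && (n == q)]
     - B * ([3 == p] + [3 == q] + [n == p] + [n == q]) + 2%:Z).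
Proof. by rewrite edge_form_lt; [|lia..]. Qed.

(** The diagonal entry of row [i] divided by 2(n-4)!, up to sign. *)
Definition row_factor (i : nat) : nat :=
  if i == 1%N then (2 ^ odd n)%N else if (i <= n - 2)%N then (n - 1)%N
  else if i == (n - 1)%N then ((n - 1) * 2 ^ (~~ odd n))%N
  else ((n - 1) * (n - 2))%N.

(** The column is an arbitrary pair, so that only the row index needs a case distinction. To precede
    [ypair n i] in [revlex] is to lie left of the diagonal. *)
Lemma gram_row i : (1 <= i <= nvec n)%N -> (p, q) != (2, 3)%N ->
  exists (s : bool) (w : int),
  [/\ spform (xvec n i) (edge p q) = (-1) ^+ s * (K0%:Z * w),
      revlex (p, q) (ypair n i) -> w = 0,
      (p, q) = ypair n i -> `|w|%N = row_factor i
    & ((row_factor i)%:Z %| w)%Z].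
Proof.
move=> /andP[i1 im] pq23; rewrite /row_factor.
have [iE|i_ne1] := eqVneq i 1%N.
  have yE : ypair n 1 = (n - 1, n)%N by rewrite /ypair ifT; last by lia.
  have no_revlex : ~~ revlex (p, q) (n - 1, n)%N by rewrite /revlex /=; lia.
  rewrite iE yE (xvec_1 n6) -/n4 Defs.formNl; case: ifP => n_odd.
    rewrite form_34; set w := (X in _ * X); exists true, w; split.
    - by rewrite expr1 mulN1r.
    - by rewrite (negPf no_revlex).
    (* As n >= 6, the edges {3, 4} and {n - 1, n} are disjoint, which leaves the value 2. *)
    - case=> pE qE; rewrite /w pE qE.
      have [-> ->] : (3 == n - 1)%N = false /\ (4 == n - 1)%N = false by lia.
      have [-> ->] : (3 == n) = false /\ (4 == n) = false by lia.
      by rewrite mulr0 mulr0 sub0r oppr0 add0r.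
    have [h nE] : exists h : nat, n = h.*2.+1 by exists n./2; lia.
    apply/dvdzP; exists (h%:Z * (n - 2)%N%:Z * [(3 == p) && (4 == q)]
     - h%:Z * ([3 == p] + [3 == q] + [4 == p] + [4 == q]) + 1).
    rewrite /w; have -> : B = h%:Z * 2 by lia.
    by rewrite expn1; ring.
  rewrite Defs.formDl pmulrn spformZl form_34 form_3n.
  exists true; eexists; split.
  - by rewrite expr1 mulN1r [X in _ + X]mulrCA -mulrDr; reflexivity.
  - by rewrite (negPf no_revlex).
  (* The edge {3, n} contributes 2 - (n - 1), and {3, 4} with its coefficient (n - 2)/2 adds n - 2;
     the entry is 1. *)
  - case=> pE qE; rewrite pE qE.
    have [-> ->] : (3 == n - 1)%N = false /\ (4 == n - 1)%N = false by lia.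
    have [-> ->] : (3 == n) = false /\ (4 == n) = false by lia.
    have -> : (n == n - 1)%N = false by lia.
    have [h nE] : exists h : nat, n = h.*2.+2 by exists (n - 2)./2; lia.
    have -> : (n - 2)./2 = h by lia.
    rewrite eqxx /=.
    have -> : B = (n - 2)%N%:Z + 1 by lia.
    have -> : (n - 2)%N%:Z = h%:Z * 2 by lia.
    by set w := (X in absz X); have -> : w = 1 by [rewrite /w; ring].
  by rewrite expn0 dvd1z.
have [i_mid|i_gt] := leqP i (n - 2).
  rewrite (xvec_mid n6) -/n4; last by lia.
  rewrite spformZl form_mid; last by lia.
  exists (odd i.+1); eexists; split.
  - by rewrite signr_odd -[K0%:Z * B * _]mulrA; reflexivity.
  - rewrite /ypair i_mid /revlex /= => rl.
    have -> : (n - i == p)%N = false by lia.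
    have -> : (n - i == q)%N = false by lia.
    by rewrite /=; ring.
  - rewrite /ypair i_mid => -[pE qE]; rewrite pE qE eqxx.
    have -> : (n - 1 == n)%N = false by lia.
    have -> : (n - i == n)%N = false by lia.
    by rewrite andbF /= (_ : _ - 1 - 0 = - 1) ?mulrN1 ?abszN //; ring.
  exact: dvdz_mulr.
have [i_eq|i_ne] := eqVneq i (n - 1)%N.
  rewrite i_eq (xvec_n1 n6) Defs.formNl.
  have yE : ypair n (n - 1)%N = (n - 2, n - 1)%N.
    rewrite /ypair ifF; last by lia.
    by rewrite ifT; [congr (_, _)|]; lia.
  have cE : (2 <= n - 2 < n - 1)%N by lia.
  have c23 : (n - 2, n - 1)%N != (2, 3)%N by rewrite xpair_eqE; lia.
  have nn : (n - 1 <= n)%N by lia.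
  rewrite yE /revlex /=.
  (* The 4-cycle part of row n - 1, divided by 2(n-4)! (n-1)(n-2). *)
  pose C : int := [(n - 2 == p)%N && (n - 1 == q)%N] - [(p == 2) && (q == n - 2)%N].
  have C0 : q = n -> C = 0.
    rewrite /C => ->; have -> : (n - 1 == n)%N = false by lia.
    have -> : (n == n - 2)%N = false by lia.
    by rewrite !andbF.
  have C1 : (p, q) = (n - 2, n - 1)%N -> C = 1.
    rewrite /C => -[-> ->]; rewrite !eqxx.
    have -> : (n - 2 == 2)%N = false by lia.
    by rewrite subr0.
  case: ifP => n_odd.
    have [h nE] : exists h : nat, n = h.*2.+1 by exists n./2; lia.
    have [h1 h2] : ((n - 3)./2 = h - 1)%N /\ (n - 1)./2 = h by lia.
    rewrite Defs.formDl !pmulrn !spformZl form_wspart form_cyc // h1 h2 -/C.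
    exists true, (B * ((n - 2)%N%:Z * C * (h - 1)%N%:Z + h%:Z * wspart_factor)).
    split.
    - by rewrite expr1; ring.
    (* Only the pairs with q = n precede (n - 2, n - 1), and there both parts vanish. *)
    - move=> rl; have qE : q = n by clear - rl pq qn; lia.
      by rewrite C0 // wspart_factor0 // !(mulr0, mul0r, addr0).
    - move=> E; rewrite C1 // wspart_factor_diag // expn0 muln1.
      rewrite (_ : _ + _ = 1) ?mulr1 ?absz_nat //.
      have -> : (n - 2)%N%:Z = 2 * h%:Z - 1 by clear - n6 nE; lia.
      have -> : (h - 1)%N%:Z = h%:Z - 1 by clear - n6 nE; lia.
      ring.
    by rewrite expn0 muln1; exact: dvdz_mulr.
  have [h nE] : exists h : nat, n = h.*2 by exists n./2; lia.
  rewrite Defs.formDl form_wspart form_cyc // -/C.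
  exists true, (B * ((n - 2)%N%:Z * C + wspart_factor)); split.
  - by rewrite expr1; ring.
  - move=> rl; have qE : q = n by clear - rl pq qn; lia.
    by rewrite C0 // wspart_factor0 // !(mulr0, mul0r, addr0).
  - move=> E; rewrite C1 // wspart_factor_diag // expn1.
    rewrite (_ : _ * 1 + _ = 2); first by rewrite abszM absz_nat.
    by ring.
  (* For even n each term contains n - 2 or 2, so the cofactor of n - 1 is even. *)
  rewrite expn1 PoszM dvdz_mul // /wspart_factor.
  set X := (X in _ * X - _); set Y := [3 == p] + [3 == q]; set Z := (Z in 2%:Z * Z).
  set T := (T in _ + _ * T).
  have -> : (n - 2)%N%:Z = (h - 1)%N%:Z * 2 by clear - n6 nE; lia.
  apply/dvdzP; exists ((h - 1)%N%:Z * C + ((h - 1)%N%:Z * X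
    - ((h - 1)%N%:Z * Y + Z + (h - 1)%N%:Z * T) + 1)).
  ring.
have i_hi : (n <= i)%N by lia.
have i_hi' : (n <= i <= nvec n)%N by rewrite i_hi.
have [|b2 bc cn ne] := @ypair_mem n n6 i; first by rewrite i1.
rewrite (xvec_hi n6 i_hi') spformZl form_cyc ?b2 -?surjective_pairing //.
exists (odd ((ypair n i).1 + (ypair n i).2)).
exists (B * (n - 2)%N%:Z * ([((ypair n i).1 == p) && ((ypair n i).2 == q)]
  - [(p == 2) && (q == (ypair n i).1)])); split.
- by rewrite signr_odd !mulrA.
- rewrite /revlex /= => rl.
  have -> : ((ypair n i).1 == p) && ((ypair n i).2 == q) = false by lia.
  have -> : (p == 2) && (q == (ypair n i).1) = false by lia.
  by rewrite subr0 mulr0.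
- move=> <- /=; rewrite !eqxx /=.
  have -> : (p == 2) && (q == p) = false by lia.
  by rewrite subr0 mulr1.
by rewrite PoszM; exact: dvdz_mulr.
Qed.

End GramValues.

(** * Spanning *)

Lemma mulrz_sign_eq0 (V : zmodType) (v : V) k : (v *~ (-1) ^+ k == 0) = (v == 0).
Proof.
by rewrite -signr_odd; case: odd; rewrite ?expr1 ?mulrN1z ?oppr_eq0 ?expr0.
Qed.

Section Span.
Variables (n : nat) (lam : seq nat) (m : nat).
Variable x : 'I_m -> permmod n lam.

Definition in_span : {pred permmod n lam} := fun v =>
  `[< exists z : {ffun 'I_m -> int}, v = \sum_i x i *~ z i >].

Lemma in_span_closed : zmod_closed in_span.
Proof.
split=> [|u v /asboolP[a ->] /asboolP[b ->]]; apply/asboolP.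
  by exists [ffun=> 0]; rewrite big1 // => i _; rewrite ffunE mulr0z.
exists [ffun i => a i - b i]; rewrite -sumrB.
by apply: eq_bigr => i _; rewrite ffunE mulrzBr.
Qed.
HB.instance Definition _ :=
  GRing.isZmodClosed.Build (permmod n lam) in_span in_span_closed.

(** Generation by [x] is proved by showing that all polytabloids vanish in this quotient of
    M^lambda. *)
Definition span_quot : zmodType := Quotient.quot (in_span : zmodClosed _).

Definition span_pi (v : permmod n lam) : span_quot := (\pi_span_quot v)%qT.

Lemma span_pi_is_zmod_morphism : zmod_morphism span_pi.
Proof. by move=> u v; rewrite /span_pi raddfB. Qed.
HB.instance Definition _ := GRing.isZmodMorphism.Build (permmod n lam)
  span_quot span_pi span_pi_is_zmod_morphism.

Lemma span_pi_eq0 v : (span_pi v == 0) = (v \in in_span).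
Proof.
by rewrite -(raddf0 span_pi) -[in RHS](subr0 v) Quotient.idealrBE.
Qed.

Lemma span_pi_gen i : span_pi (x i) = 0.
Proof.
apply/eqP; rewrite span_pi_eq0; apply/asboolP.
exists [ffun j => (j == i)%:R]; rewrite (bigD1 i) //= ffunE eqxx mulr1z.
by rewrite big1 ?addr0 // => j /negPf ji; rewrite ffunE ji mulr0z.
Qed.

Lemma span_piMz v z : span_pi (v *~ z) = span_pi v *~ z.
Proof. exact: raddfMz. Qed.

Lemma span_piD u v : span_pi (u + v) = span_pi u + span_pi v.
Proof. exact: raddfD. Qed.

Lemma span_piN v : span_pi (- v) = - span_pi v.
Proof. exact: raddfN. Qed.

Lemma span_piMn v k : span_pi (v *+ k) = span_pi v *+ k.
Proof. exact: raddfMn. Qed.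

Lemma span_pi_sum (I : Type) (r : seq I) (P : pred I) F :
  span_pi (\sum_(i <- r | P i) F i) = \sum_(i <- r | P i) span_pi (F i).
Proof. exact: raddf_sum. Qed.

Lemma span_pi0 : span_pi 0 = 0.
Proof. exact: raddf0. Qed.

Lemma specht_in_span :
  (forall t : filling n lam, is_tableau t -> span_pi (polytabloid t) = 0) ->
  forall v, v \in @in_specht n lam -> v \in in_span.
Proof.
move=> tx v /asboolP[z ->]; rewrite -span_pi_eq0 span_pi_sum big1 // => t tP.
by rewrite span_piMz tx // mul0rz.
Qed.

End Span.

Section Spanning.
Variable n : nat.
Hypothesis n6 : (6 <= n)%N.
Let n4 : (4 <= n)%N := ltnW (ltnW n6).
Local Notation edge := (edge n4).
Let x (i : 'I_(nvec n)) := xvec n i.+1.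
Let y (i : 'I_(nvec n)) := yvec n i.+1.

Lemma specht_span_edges (m : nat) (u : 'I_m -> permmod n (lam22 n)) :
  (forall a b, (1 <= a < b)%N -> (b <= n)%N -> span_pi u (edge a b) = 0) ->
  forall v, v \in @in_specht n (lam22 n) -> v \in in_span u.
Proof.
move=> eu; apply: specht_in_span => t tP.
have [a [b [c [ab bn ->]]]] := polytabloid_edge n4 tP.
by rewrite span_piMz eu // mul0rz.
Qed.

Lemma span_pi_star (m : nat) (u : 'I_m -> permmod n (lam22 n)) a :
  (1 <= a <= n)%N -> \sum_(1 <= b < n.+1 | b != a) span_pi u (edge a b) = 0.
Proof. by move=> an; rewrite -span_pi_sum edge_star // span_pi0. Qed.

Lemma span_pi_total (m : nat) (u : 'I_m -> permmod n (lam22 n)) :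
  \sum_(1 <= b < n.+1) \sum_(1 <= a < b) span_pi u (edge a b) = 0.
Proof.
rewrite -[RHS](span_pi0 u) -(edge_total n4) span_pi_sum.
by apply: eq_bigr => b _; rewrite span_pi_sum.
Qed.

Lemma ex_index i : (1 <= i <= nvec n)%N -> exists k : 'I_(nvec n), i = k.+1.
Proof. by case: i => // i /= h; exists (Ordinal h). Qed.

Lemma specht_span_y v : v \in @in_specht n (lam22 n) -> v \in in_span y.
Proof.
apply: specht_span_edges; apply: edges_vanish_of_y.
- by move=> a b; rewrite edgeC.
- exact: span_pi_star.
- exact: span_pi_total.
- by lia.
move=> a b ab bn ne; have [i /ex_index[k iE] yE] := ypair_onto n6 ab bn ne.
have := span_pi_gen y k; rewrite /y -iE yvec_ypair yE /=.
rewrite (br_edge n4) //; last by lia.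
by rewrite span_piMz => /eqP; rewrite mulrz_sign_eq0 => /eqP.
Qed.

Lemma span_x_vec i : (1 <= i <= nvec n)%N -> span_pi x (xvec n i) = 0.
Proof. by case/ex_index => k ->; exact: span_pi_gen. Qed.

(** Such a pair is [ypair n i] with i >= n: the bound on [c] rules out the first block, and (n - 2,
    n - 1) is the only pair of the second block without a 4-cycle of its own among the x_i. *)
Lemma span_x_cyc b c : (2 <= b < c)%N -> (c <= n - 1)%N ->
  (b, c) != (2, 3)%N -> (b, c) != (n - 2, n - 1)%N -> span_pi x (cyc n6 b c) = 0.
Proof.
move=> /andP[b2 bc] cn ne ne'.
have [|||i im iE] := @ypair_onto n n6 b c; [lia|lia|by []|].
have ni : (n <= i)%N.
  have [//|i_lt] := leqP n i; move: iE; rewrite /ypair.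
  case: ifP => i2; first by case; lia.
  rewrite ifT; last by lia.
  by case=> bE cE; move: ne'; rewrite xpair_eqE; lia.
have := span_x_vec im; rewrite (xvec_hi n6) ?ni ?(andP im).2 // iE span_piMz.
by move/eqP; rewrite mulrz_sign_eq0 => /eqP.
Qed.

Lemma specht_span_x v : v \in @in_specht n (lam22 n) -> v \in in_span x.
Proof.
apply: specht_span_edges.
have := @edges_vanish_of_x (span_quot x) (n - 3) (fun a b => span_pi x (edge a b)).
have [E3 E2 E1] : [/\ (n - 3).+3 = n, (n - 3).+2 = n - 1 & (n - 3).+1 = n - 2]%N.
  by split; lia.
cbv beta zeta; rewrite E3 E2 E1; apply.
- by lia.
- by move=> a b; rewrite edgeC.
- exact: span_pi_star.
- exact: span_pi_total.
(* The vector x_{n-k} identifies the edges {1, n - 1} and {k, n - 1}. *)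
- move=> k k2; have : span_pi x (xvec n (n - k)) = 0.
    by apply: span_x_vec; rewrite /nvec; lia.
  rewrite (xvec_mid n6); last by lia.
  rewrite span_piMz (_ : n - (n - k) = k)%N; last by lia.
  move/eqP; rewrite mulrz_sign_eq0 span_piD span_piN subr_eq0 => /eqP->.
  by [].
- move=> b c bc cn ne; have := @span_x_cyc b c; rewrite /cyc ifF; last by lia.
  rewrite !span_piD !span_piN; apply => //; first by lia.
  by rewrite xpair_eqE; lia.
- move=> c cn; have := @span_x_cyc 2 c; rewrite /cyc eqxx.
  rewrite !span_piD !span_piN; apply; try lia.
    by rewrite xpair_eqE; lia.
  by rewrite xpair_eqE; lia.
- have : span_pi x (xvec n 1) = 0 by apply: span_x_vec; rewrite /nvec; lia.
  rewrite (xvec_1 n6) span_piN => /eqP; rewrite oppr_eq0 => /eqP <-.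
  by case: (odd n) => //; rewrite span_piD span_piMn.
have : span_pi x (xvec n (n - 1)) = 0.
  by apply: span_x_vec; rewrite /nvec; lia.
rewrite (xvec_n1 n6) span_piN => /eqP; rewrite oppr_eq0 => /eqP <-.
rewrite /cyc (_ : (n - 2 == 2)%N = false); last by lia.
by case: (odd n) => //; rewrite !(span_piD, span_piN, span_piMn).
Qed.

End Spanning.

(** * Lattices with a triangular Gram matrix *)

(** The first isomorphism theorem; the inverse picks preimages by choice. *)
Lemma isomorphic_quot (A B : zmodType) (I : zmodClosed A) (f : {additive A -> B}) :
  (forall a, (a \in I) = (f a == 0)) -> (forall b, exists a, f a = b) ->
  isomorphic (Quotient.quot I) B.
Proof.
move=> fI f_onto; pose g (q : Quotient.quot I) : B := f (generic_quotient.repr q).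
have g_pi a : g (\pi_(Quotient.quot I)%qT a) = f a.
  apply/eqP; rewrite -subr_eq0 -raddfB -fI Quotient.idealrBE.
  by rewrite reprK.
have g_zmod : zmod_morphism g.
  by move=> p q; rewrite -[p]reprK -[q]reprK -raddfB !g_pi raddfB.
pose gM := GRing.isZmodMorphism.Build _ _ g g_zmod.
pose gA : {additive Quotient.quot I -> B} := HB.pack g gM.
exists gA; have [h hK] := choice f_onto.
exists (fun b => \pi_(Quotient.quot I)%qT (h b)) => [q|b]; last first.
  by rewrite /= g_pi hK.
rewrite /= -[RHS]reprK; apply/eqP; rewrite -Quotient.idealrBE fI raddfB.
by rewrite hK subrr.
Qed.

Section Lattice.
Variables (n : nat) (lam : seq nat) (m : nat).
Implicit Types (x y b : 'I_m -> permmod n lam) (z : 'rV[int]_m).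

Lemma spform_lin x y z (j : 'I_m) :
  spform (\sum_i x i *~ z 0 i) (y j) = (z *m gram x y) 0 j.
Proof.
by rewrite spform_suml mxE; apply: eq_bigr => i _; rewrite spformZl mxE.
Qed.

Lemma gramT x y : (gram x y)^T = gram y x.
Proof. by apply/matrixP => i j; rewrite !mxE spformC. Qed.

Lemma row_mul_eq0 (U : 'M[int]_m) z : \det U != 0 -> z *m U = 0 -> z = 0.
Proof.
move=> dU zU; have := mulmxA z U (\adj U); rewrite zU mul0mx mul_mx_adj mul_mx_scalar.
by move/eqP; rewrite scalemx_eq0 (negPf dU) => /eqP.
Qed.

Lemma sumrzB x (z z' : {ffun 'I_m -> int}) :
  \sum_i x i *~ z i - \sum_i x i *~ z' i
    = \sum_i x i *~ (\row_j (z j - z' j)) 0 i.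
Proof. by rewrite -sumrB; apply: eq_bigr => i _; rewrite mxE mulrzBr. Qed.

(** Pairing a relation among the x_i with all y_j gives a row killed by a nonsingular matrix, so
    generators are independent. *)
Lemma Zbasis_of_gram x y : \det (gram x y) != 0 ->
  (forall i, x i \in @in_specht n lam) ->
  (forall v, v \in @in_specht n lam -> v \in in_span x) ->
  Zbasis_specht x.
Proof.
move=> dU xS xspan; split=> // v /xspan/asboolP[z vE]; exists z; split=> // z' vE'.
have /eqP := vE'; rewrite {1}vE -subr_eq0 sumrzB => /eqP zz'.
have /row_mul_eq0 : \row_j (z j - z' j) *m gram x y = 0.
  apply/rowP => j; rewrite -spform_lin zz' spform0l mxE //.
move/(_ dU)/rowP => E; apply/ffunP => j; have := E j; rewrite !mxE.
by move/eqP; rewrite subr_eq0 => /eqP.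
Qed.

Lemma Zbasis_uniq b z z' : Zbasis_specht b ->
  \sum_i b i *~ z 0 i = \sum_i b i *~ z' 0 i -> z = z'.
Proof.
move=> [bS bB] E; pose f (w : 'rV[int]_m) := [ffun i => w 0 i].
have fE w : \sum_i b i *~ f w i = \sum_i b i *~ w 0 i.
  by apply: eq_bigr => i _; rewrite ffunE.
have vS : \sum_i b i *~ z 0 i \in @in_specht n lam.
  by apply: rpred_sum => i _; apply: rpredMz.
have [u [_ u_uniq]] := bB _ vS.
have /ffunP zz' : f z = f z'.
  by rewrite -(u_uniq (f z)) ?fE // -(u_uniq (f z')) ?fE.
by apply/rowP => i; have := zz' i; rewrite !ffunE.
Qed.

Lemma Zbasis_change b x : Zbasis_specht b -> Zbasis_specht x ->
  exists2 P : 'M[int]_m, \det P \is a GRing.unit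
    & forall i, x i = \sum_j b j *~ P i j.
Proof.
have ex (c d : 'I_m -> permmod n lam) : Zbasis_specht c -> Zbasis_specht d ->
    exists P : 'M[int]_m, forall i, d i = \sum_j c j *~ P i j.
  move=> [_ cB] [dS _].
  have /choice[P PE] : forall i, exists z : {ffun 'I_m -> int}, d i = \sum_j c j *~ z j.
    by move=> i; have [z [-> _]] := cB _ (dS i); exists z.
  exists (\matrix_(i, j) P i j) => i; rewrite PE.
  by apply: eq_bigr => j _; rewrite mxE.
move=> bB xB; have [P PE] := ex _ _ bB xB; have [Q QE] := ex _ _ xB bB.
exists P => //; have PQ : P *m Q = 1%:M.
  apply/row_matrixP => i; apply: (Zbasis_uniq xB).
  transitivity (x i); last first.
    rewrite (bigD1 i) //= !mxE eqxx mulr1z big1 ?addr0 // => j /negPf ji.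
    by rewrite !mxE eq_sym ji mulr0z.
  rewrite [RHS]PE; transitivity (\sum_j (\sum_k x k *~ Q j k) *~ P i j).
    transitivity (\sum_k \sum_j x k *~ Q j k *~ P i j).
      apply: eq_bigr => k _; rewrite !mxE mulrz_sumr; apply: eq_bigr => j _.
      by rewrite mulrC mulrzA.
    by rewrite exchange_big; apply: eq_bigr => j _; rewrite mulrz_suml.
  by apply: eq_bigr => j _; rewrite -QE.
have : \det P * \det Q = 1 by rewrite -det_mulmx PQ det1.
by move=> detPQ; apply/unitrPr; exists (\det Q).
Qed.

Lemma gram_change b x y (P Q : 'M[int]_m) :
  (forall i, x i = \sum_j b j *~ P i j) -> (forall i, y i = \sum_j b j *~ Q i j) ->
  gram x y = P *m gram b b *m Q^T.
Proof.
move=> xE yE; apply/matrixP => i j; rewrite !mxE xE yE spform_sumr.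
apply: eq_bigr => k _; rewrite spformZr spform_suml !mxE mulrC; congr (_ * _).
by apply: eq_bigr => l _; rewrite spformZl mxE.
Qed.

(** Both base changes from [b] are invertible over Z, hence of determinant 1 or -1. *)
Lemma gram_det b x y : Zbasis_specht b -> Zbasis_specht x -> Zbasis_specht y ->
  \det (gram x y) = \det (gram b b) \/ \det (gram x y) = - \det (gram b b).
Proof.
move=> bB xB yB; have [P Pu PE] := Zbasis_change bB xB.
have [Q Qu QE] := Zbasis_change bB yB.
rewrite (gram_change PE QE) !det_mulmx det_tr.
by case/orP: Pu => /eqP ->; case/orP: Qu => /eqP ->;
  rewrite ?(mul1r, mulr1, mulN1r, mulrN1, opprK); auto.
Qed.

End Lattice.

Section DualCoordinates.
Variables (n : nat) (lam : seq nat) (m : nat).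
Variables x y : 'I_m -> permmod n lam.
Hypotheses (xB : Zbasis_specht x) (yB : Zbasis_specht y).
Let U := gram x y.
Hypothesis U_lower : forall i j : 'I_m, (j < i)%N -> U i j = 0.
Hypothesis U_diag : forall i, U i i != 0.
Hypothesis U_dvd : forall i j, (U i i %| U i j)%Z.

Local Notation S := (specht n lam).

(** Divides each row of [U] by its diagonal entry: U = D V with D diagonal and V upper unitriangular
    over Z. *)
Let V : 'M[int]_m := \matrix_(i, j) (U i j %/ U i i)%Z.

Lemma unitmx_V : V \in unitmx.
Proof.
rewrite unitmxE -det_tr det_trig => [|]; last first.
  apply/is_trig_mxP => i j ij; rewrite !mxE -/U.
  have := U_lower ij; rewrite /U mxE => ->; exact: div0z.
by rewrite big1 // => i _; rewrite !mxE divzz; have := U_diag i; rewrite mxE => ->.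
Qed.

Lemma row_mulU (z : 'rV[int]_m) :
  z *m U = (\row_i (z 0 i * U i i)) *m V.
Proof.
apply/rowP => j; rewrite mxE [RHS]mxE; apply: eq_bigr => i _.
have -> : V i j = (U i j %/ U i i)%Z by rewrite mxE.
by rewrite [X in _ = X * _]mxE -mulrA [X in _ = _ * X]mulrC divzK.
Qed.

Definition y_specht (j : 'I_m) : S := exist _ (y j) (yB.1 j).

Lemma hom_additive (f : Zdual S) :
  exists g : {additive S -> int}, forall a, (val f : S -> int) a = g a.
Proof.
have fM : zmod_morphism (val f : S -> int).
  have /asboolP fD := valP f; move=> a b.
  by apply/eqP; rewrite eq_sym subr_eq -fD subrK.
pose gM := GRing.isZmodMorphism.Build _ _ (val f : S -> int) fM.
pose g : {additive S -> int} := HB.pack (val f : S -> int) gM.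
by exists g.
Qed.

Lemma y_specht_span (a : S) : exists c : {ffun 'I_m -> int}, a = \sum_j y_specht j *~ c j.
Proof.
have [c [aE _]] := yB.2 _ (valP a); exists c; apply: val_inj.
rewrite raddf_sum aE; apply: eq_bigr => j _.
by rewrite raddfMz.
Qed.

(** The values of [f] on the basis [y], times V^-1. The functionals (xi, -) have value rows z U = (z
    D) V and so become the rows z D, which turns membership in the image into divisibility of each
    coordinate. *)
Definition dual_row (f : Zdual S) : 'rV[int]_m :=
  (\row_j (val f : S -> int) (y_specht j)) *m invmx V.

Lemma dual_row_zmod : zmod_morphism dual_row.
Proof.
move=> f g; rewrite /dual_row -mulmxBl; congr (_ *m _); apply/rowP => j.
by rewrite !mxE.
Qed.
HB.instance Definition _ := GRing.isZmodMorphism.Build (Zdual S) 'rV[int]_m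
  dual_row dual_row_zmod.

Lemma dual_row_image f : (f \in @in_form_image n lam)
  = [forall i, (U i i %| dual_row f ord0 i)%Z].
Proof.
apply/asboolP/forallP => [[xi xiE] i|Ud].
  have [z [xi_z _]] := xB.2 _ (valP xi).
  suff -> : dual_row f = \row_i (z i * U i i) by rewrite mxE dvdz_mull.
  have -> : \row_i (z i * U i i) = \row_i ((\row_k z k) 0 i * U i i).
    by apply/rowP => k; rewrite !mxE.
  rewrite /dual_row -[RHS](mulmxK unitmx_V) -row_mulU; congr (_ *m _).
  apply/rowP => j; rewrite -spform_lin mxE xiE xi_z /=; congr (spform _ _).
  by apply: eq_bigr => k _; rewrite mxE.
pose z : 'rV[int]_m := \row_i (dual_row f ord0 i %/ U i i)%Z.
have zE : \row_j (val f : S -> int) (y_specht j) = z *m U.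
  rewrite row_mulU -[LHS](mulmxKV unitmx_V); congr (_ *m _).
  by apply/rowP => i; rewrite [RHS]mxE [z _ _]mxE divzK.
have xiS : \sum_i x i *~ z 0 i \in @in_specht n lam.
  by apply: rpred_sum => i _; apply: rpredMz; exact: xB.1.
exists (exist (fun v => v \in @in_specht n lam) _ xiS) => eta.
have [c etaE] := y_specht_span eta.
have [g gE] := hom_additive f; rewrite gE {1}etaE raddf_sum.
rewrite [in RHS]etaE raddf_sum spform_sumr.
apply: eq_bigr => j _; rewrite !raddfMz /= spformZr spform_lin -zE mxE gE.
by rewrite mulrzz mulrC.
Qed.

(** A functional may be prescribed on the basis [y]. It is built from chosen coordinates [c], which
    are additive because coordinates are unique. *)
Lemma dual_row_onto w : exists f, dual_row f = w.
Proof.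
have /choice[c cE] := y_specht_span.
have sE (s : S) : val s = \sum_j y j *~ c s j.
  by rewrite {1}(cE s) raddf_sum; apply: eq_bigr => j _; rewrite raddfMz.
pose r := w *m V.
have cD a b : c (a + b) = [ffun j => c a j + c b j].
  have E : \sum_j y j *~ (\row_j c (a + b) j) 0 j
         = \sum_j y j *~ (\row_j (c a j + c b j)) 0 j.
    transitivity (val (a + b)).
      by rewrite sE; apply: eq_bigr => j _; rewrite mxE.
    rewrite raddfD /= !sE -big_split.
    by apply: eq_bigr => j _; rewrite mxE mulrzDr.
  have /rowP E' := Zbasis_uniq yB E.
  by apply/ffunP => j; have := E' j; rewrite !mxE ffunE.
pose f a := \sum_j r 0 j * c a j.
have fH : f \in @is_hom S.
  apply/asboolP => a b; rewrite /f cD -big_split; apply: eq_bigr => j _.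
  by rewrite ffunE mulrDr.
exists (exist (fun g => g \in @is_hom S) f fH).
rewrite /dual_row -[RHS](mulmxK unitmx_V) -/r.
congr (_ *m _); apply/rowP => k; rewrite mxE /= /f.
have E : \sum_j y j *~ (\row_j c (y_specht k) j) 0 j
       = \sum_j y j *~ (\row_j (j == k)%:R) 0 j.
  transitivity (val (y_specht k)).
    by rewrite sE; apply: eq_bigr => j _; rewrite mxE.
  rewrite [RHS](bigD1 k) //= mxE eqxx mulr1z big1 ?addr0 // => j /negPf jk.
  by rewrite mxE jk mulr0z.
have /rowP E' := Zbasis_uniq yB E.
rewrite (bigD1 k) //= big1 ?addr0 => [|j /negPf jk].
  by have := E' k; rewrite !mxE eqxx => ->; rewrite mulr1.
by have := E' j; rewrite !mxE jk => ->; rewrite mulr0.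
Qed.

End DualCoordinates.

(** * Invariant factors *)

Lemma Zp_intr_eq0 (d : nat) (z : int) : (1 < d)%N ->
  ((z%:~R : 'Z_d) == 0) = (d%:Z %| z)%Z.
Proof.
move=> d1; have natE (k : nat) : ((k%:R : 'Z_d) == 0) = (d %| k)%N.
  by rewrite -val_eqE /= val_Zp_nat // /dvdn.
by case: z => k; rewrite dvdzE ?NegzE ?mulrNz ?oppr_eq0 -pmulrn natE.
Qed.

Section Blocks.
Variable m : nat.
Implicit Types w : 'rV[int]_m.

(** Indexed by natural numbers, so that blocks can be cut out by offsets without casts. *)
Definition coord w (k : nat) : int := if insub k is Some i then w 0 i else 0.

Lemma coord_ord w (i : 'I_m) : coord w i = w 0 i.
Proof. by rewrite /coord valK. Qed.

Lemma coordB w w' k : coord (w - w') k = coord w k - coord w' k.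
Proof. by rewrite /coord; case: insub => [i|]; rewrite ?mxE ?subr0. Qed.

Lemma coord_row (W : nat -> int) k : (k < m)%N -> coord (\row_i W i) k = W k.
Proof. by move=> km; rewrite (coord_ord _ (Ordinal km)) mxE. Qed.

Definition block (off d k : nat) w : Zmod_pow d k :=
  [ffun i : 'I_k => (coord w (off + i))%:~R].

Lemma blockB off d k w w' :
  block off d k (w - w') = block off d k w - block off d k w'.
Proof. by apply/ffunP => i; rewrite !ffunE coordB rmorphB. Qed.

Lemma block_eq0 off d k w : (1 < d)%N ->
  block off d k w = 0 <-> forall i, (i < k)%N -> (d%:Z %| coord w (off + i))%Z.
Proof.
move=> d1; split=> [/ffunP E i ik|E].
  by have := E (Ordinal ik); rewrite !ffunE => /eqP; rewrite Zp_intr_eq0.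
by apply/ffunP => i; rewrite !ffunE; apply/eqP; rewrite Zp_intr_eq0 ?E.
Qed.

Definition lift_block (d k : nat) (g : Zmod_pow d k) (i : nat) : int :=
  if insub i is Some j then (val (g j))%:Z else 0.

Lemma block_lift (off d k : nat) (g : Zmod_pow d k) w :
  (forall i, (i < k)%N -> coord w (off + i) = lift_block g i) ->
  block off d k w = g.
Proof.
move=> wE; apply/ffunP => i; rewrite ffunE wE // /lift_block valK.
by rewrite -pmulrn natr_Zp.
Qed.

End Blocks.

(** * The triangular matrix of x and y, and the cokernel *)

Section GramMatrix.
Variable n : nat.
Hypothesis n6 : (6 <= n)%N.
Let x (i : 'I_(nvec n)) := xvec n i.+1.
Let y (i : 'I_(nvec n)) := yvec n i.+1.

Lemma gram_xy (i j : 'I_(nvec n)) : exists (s : bool) (w : int),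
  [/\ gram x y i j = (-1) ^+ s * ((2 * (n - 4)`!)%N%:Z * w),
      (j < i)%N -> w = 0,
      i = j -> `|w|%N = row_factor n i.+1
    & ((row_factor n i.+1)%:Z %| w)%Z].
Proof.
have iP : (1 <= i.+1 <= nvec n)%N by rewrite /= ltn_ord.
have jP : (1 <= j.+1 <= nvec n)%N by rewrite /= ltn_ord.
have [p2 pq qn ne] := ypair_mem n6 jP.
have := gram_row n6 p2 pq qn iP; rewrite -surjective_pairing => /(_ ne).
case=> s [w [G G0 Gd Gdvd]].
exists (s (+) odd ((ypair n j.+1).1 + (ypair n j.+1).2)), w; split=> //.
- rewrite mxE /x /y yvec_ypair (br_edge (ltnW (ltnW n6))) //; last first.
    by rewrite pq andbT; lia.
  by rewrite spformZr -signr_odd G signr_addb mulrA [X in X * _]mulrC -mulrA.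
- by move=> ji; apply/G0/ypair_revlex => //; rewrite ?ltnS.
by move=> ij; apply: Gd; rewrite ij.
Qed.

Lemma gram_lower (i j : 'I_(nvec n)) : (j < i)%N -> gram x y i j = 0.
Proof. by move=> ji; have [s [w [-> /(_ ji) -> _ _]]] := gram_xy i j; rewrite !mulr0. Qed.

Lemma gram_diag (i : 'I_(nvec n)) :
  `|gram x y i i|%N = (2 * (n - 4)`! * row_factor n i.+1)%N.
Proof.
have [s [w [-> _ /(_ erefl) <- _]]] := gram_xy i i.
by rewrite abszMsign abszM.
Qed.

Lemma gram_dvd (i j : 'I_(nvec n)) : (gram x y i i %| gram x y i j)%Z.
Proof.
rewrite dvdzE gram_diag; have [s [w [-> _ _ wd]]] := gram_xy i j.
by rewrite abszMsign abszM dvdn_mul.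
Qed.

Lemma row_factor_gt0 i : (0 < row_factor n i)%N.
Proof.
rewrite /row_factor; do !case: ifP => _; rewrite ?muln_gt0 ?expn_gt0 //; lia.
Qed.

Lemma gram_diag_neq0 (i : 'I_(nvec n)) : gram x y i i != 0.
Proof.
by rewrite -absz_gt0 gram_diag !muln_gt0 fact_gt0 row_factor_gt0.
Qed.

Lemma det_gram_xy : \det (gram x y) = \prod_i gram x y i i.
Proof.
rewrite -det_tr det_trig; first by apply: eq_bigr => i _; rewrite mxE.
by apply/is_trig_mxP => i j ij; rewrite mxE gram_lower.
Qed.

(** A matter of parity: n - 1 is even for odd n, and n - 2 is even for even n. *)
Lemma row_factor_chain i : (1 <= i)%N -> (row_factor n i %| row_factor n i.+1)%N.
Proof.
move=> i1; rewrite /row_factor.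
have -> : (i.+1 == 1)%N = false by lia.
have [->|i_ne1] := eqVneq i 1%N.
  have -> : (2 <= n - 2)%N by lia.
  by case: (boolP (odd n)) => nO; rewrite ?expn0 ?dvd1n // expn1; lia.
rewrite /=; have [i2|i2] := leqP i (n - 2).
  case: ifP => // i3; case: ifP => _; exact: dvdn_mulr.
have -> : (i.+1 <= n - 2)%N = false by lia.
have -> : (i.+1 == n - 1)%N = false by lia.
case: ifP => // _; apply: dvdn_mul => //.
by case: (boolP (odd n)) => nO; rewrite ?expn0 ?dvd1n // expn1; lia.
Qed.

Local Notation edge := (edge (ltnW (ltnW n6))).

Lemma polytabloid_specht lam (t : filling n lam) :
  is_tableau t -> polytabloid t \in @in_specht n lam.
Proof.
move=> tP; apply/asboolP; exists (fun u => (u == t)%:R).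
rewrite (bigD1 t) //= eqxx mulr1z big1 ?addr0 // => u /andP[_ /negPf ->].
by rewrite mulr0z.
Qed.

Lemma edge_specht a b : (1 <= a <= n)%N -> (1 <= b <= n)%N -> a != b ->
  edge a b \in @in_specht n (lam22 n).
Proof.
wlog ab : a b / (a < b)%N => [W|] an bn neq.
  have [ab|ba|E] := ltngtP a b; first exact: W.
    by rewrite edgeC; apply: W => //; rewrite eq_sym.
  by rewrite E eqxx in neq.
have -> : edge a b = br n a b *~ (-1) ^+ (a + b).
  rewrite (br_edge (ltnW (ltnW n6))); [|lia..].
  by rewrite -mulrzA -exprD addnn -mul2n exprM sqrrN !expr1n mulr1z.
have [[i aE] [j bE]] := (ex_ord an, ex_ord bn).
apply: rpredMz; rewrite aE bE br_ord; apply/polytabloid_specht/ab_tableauP.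
  by lia.
by move: neq; rewrite aE bE eqSS.
Qed.

Lemma cyc_specht b c : (2 <= b < c)%N -> (c <= n)%N -> (b, c) != (2, 3)%N ->
  cyc n6 b c \in @in_specht n (lam22 n).
Proof.
rewrite /cyc xpair_eqE => bc cn ne; case: ifP => b2;
  repeat (apply: rpredB || apply: rpredD); apply: edge_specht; lia.
Qed.

Lemma wspart_specht : wspart n6 \in @in_specht n (lam22 n).
Proof.
rewrite /wspart.
repeat (apply: rpredMn || apply: rpredD); apply: edge_specht; lia.
Qed.

Lemma xvec_specht i : (1 <= i <= nvec n)%N -> xvec n i \in @in_specht n (lam22 n).
Proof.
move=> /andP[i1 im]; have [->|i_ne1] := eqVneq i 1%N.
  rewrite (xvec_1 n6) rpredN; case: ifP => _;
    repeat (apply: rpredMn || apply: rpredD); apply: edge_specht; lia.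
have [i2|i2] := leqP i (n - 2).
  rewrite (xvec_mid n6); last by lia.
  by apply: rpredMz; apply: rpredB; apply: edge_specht; lia.
have [->|i_ne] := eqVneq i (n - 1)%N.
  have cS : cyc n6 (n - 2) (n - 1) \in @in_specht n (lam22 n).
    by apply: cyc_specht; rewrite ?xpair_eqE; lia.
  rewrite (xvec_n1 n6) rpredN; case: ifP => _.
    by apply: rpredD; apply: rpredMn => //; exact: wspart_specht.
  by apply: rpredD => //; exact: wspart_specht.
have [p2 pq qn ne] := @ypair_mem n n6 i (introT andP (conj i1 im)).
rewrite (xvec_hi n6); last by lia.
by apply: rpredMz; apply: cyc_specht; rewrite -?surjective_pairing // p2.
Qed.

Lemma yvec_specht i : (1 <= i <= nvec n)%N -> yvec n i \in @in_specht n (lam22 n).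
Proof.
move=> iP; have [p2 pq qn _] := ypair_mem n6 iP.
rewrite yvec_ypair (br_edge (ltnW (ltnW n6))) //; last by rewrite pq andbT; lia.
by apply: rpredMz; apply: edge_specht; lia.
Qed.

Lemma xvec_Zbasis : Zbasis_specht x.
Proof.
apply: (@Zbasis_of_gram _ _ _ x y).
- by rewrite det_gram_xy prodf_seq_neq0; apply/allP => i _; exact: gram_diag_neq0.
- by move=> i; apply: xvec_specht; rewrite /= ltn_ord.
exact: specht_span_x.
Qed.

Lemma yvec_Zbasis : Zbasis_specht y.
Proof.
apply: (@Zbasis_of_gram _ _ _ y x).
- rewrite -gramT det_tr det_gram_xy prodf_seq_neq0.
  by apply/allP => i _; exact: gram_diag_neq0.
- by move=> i; apply: yvec_specht; rewrite /= ltn_ord.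
exact: specht_span_y.
Qed.

Lemma trigonalize_xy : trigonalize x y.
Proof.
have G i j : spform (x i) (y j) = gram x y i j by rewrite mxE.
split=> [|i|i|i j ij|i j _|i j jE|b bB]; rewrite ?G.
- by exists y; exact: yvec_Zbasis.
- by split; [case: xvec_Zbasis|case: yvec_Zbasis].
- exact: gram_diag_neq0.
- exact: gram_lower.
- exact: gram_dvd.
- by rewrite dvdzE !gram_diag jE dvdn_mul // row_factor_chain.
rewrite (eq_bigr (fun i => gram x y i i)) => [|i _]; last exact: G.
by rewrite -det_gram_xy; exact: gram_det bB xvec_Zbasis yvec_Zbasis.
Qed.

Definition last_mult : nat := (n ^ 2 + 2 - 5 * n) %/ 2.

(** Both sides are the rank n(n-3)/2. With [c] the number of 2-subsets of an (n-3)-set, n^2 + 2 - 5n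
    is 2(c + n - 5). *)
Lemma nvecE : nvec n = (n - 1 + last_mult)%N.
Proof.
rewrite /nvec /last_mult bin2; set N := (n - 3)%N.
have evenN : ~~ odd (N * N.-1).
  by rewrite oddM; case: N => //= k; rewrite andNb.
have := even_halfK evenN; rewrite -mul2n; set c := (_./2) => cE.
have -> : (n ^ 2 + 2 - 5 * n = 2 * (c + n - 5))%N.
  have : (n = N + 3)%N by rewrite /N; lia.
  by have : (3 <= N)%N by [rewrite /N; lia]; clearbody N; move: cE => + + ->; nia.
(* Keeps the subtraction in [c - 1] from being truncated. *)
have : (3 * 2 <= N * N.-1)%N by apply: leq_mul; rewrite /N; lia.
by rewrite -cE mulKn // /N; lia.
Qed.

Definition invariant_sum : zmodType :=
  (Zmod_pow (2 ^ odd n * (2 * (n - 4)`!)) 1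
   * Zmod_pow ((n - 1) * (2 * (n - 4)`!)) (n - 3)
   * Zmod_pow (2 ^ (~~ odd n) * ((n - 1) * (2 * (n - 4)`!))) 1
   * Zmod_pow ((n - 2) * (n - 1) * (2 * (n - 4)`!)) last_mult)%type.

(** Offsets count from 0: the coordinate belonging to x_i has index i - 1. *)
Definition blocks (w : 'rV[int]_(nvec n)) : invariant_sum :=
  (block 0 _ 1 w, block 1 _ (n - 3) w, block (n - 2) _ 1 w, block (n - 1) _ last_mult w).

Lemma blocks_zmod : zmod_morphism blocks.
Proof. by move=> u v; rewrite /blocks !blockB. Qed.

Lemma gram_dvd_coord (w : 'rV[int]_(nvec n)) :
  (forall i : 'I_(nvec n), (gram x y i i %| w ord0 i)%Z) <->
  (forall k, (k < nvec n)%N ->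
    ((row_factor n k.+1 * (2 * (n - 4)`!))%N%:Z %| coord w k)%Z).
Proof.
split=> [E k km|E i].
  by have := E (Ordinal km); rewrite -coord_ord dvdzE gram_diag mulnC dvdzE.
rewrite -coord_ord dvdzE gram_diag mulnC.
by have := E i (ltn_ord i); rewrite dvdzE.
Qed.

(** The ring ['Z_d] is Z/d only for d > 1, which the factor 2 guarantees for all four moduli. *)
Lemma invariant_gt1 a : (0 < a)%N -> (1 < a * (2 * (n - 4)`!))%N.
Proof. by move=> a0; rewrite mulnCA leq_pmulr // muln_gt0 a0 fact_gt0. Qed.

Lemma blocks_eq0 w :
  blocks w = 0 <-> forall i : 'I_(nvec n), (gram x y i i %| w ord0 i)%Z.
Proof.
rewrite gram_dvd_coord.
have d1 : (1 < 2 ^ odd n * (2 * (n - 4)`!))%N.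
  by apply: invariant_gt1; rewrite expn_gt0.
have d2 : (1 < (n - 1) * (2 * (n - 4)`!))%N by apply: invariant_gt1; lia.
have d3 : (1 < 2 ^ (~~ odd n) * ((n - 1) * (2 * (n - 4)`!)))%N.
  by rewrite mulnA; apply: invariant_gt1; rewrite muln_gt0 expn_gt0 /=; lia.
have d4 : (1 < (n - 2) * (n - 1) * (2 * (n - 4)`!))%N.
  by apply: invariant_gt1; rewrite muln_gt0; lia.
have mE := nvecE.
have rf0 : row_factor n 1 = (2 ^ odd n)%N by [].
have rf1 k : (k < n - 3)%N -> row_factor n (1 + k).+1 = (n - 1)%N.
  move=> kn; rewrite /row_factor.
  have -> : ((1 + k).+1 == 1)%N = false by lia.
  by have -> : (1 + k < n - 2)%N by lia.
have rf2 : row_factor n (n - 2).+1 = (2 ^ (~~ odd n) * (n - 1))%N.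
  rewrite /row_factor; have -> : ((n - 2).+1 == 1)%N = false by lia.
  have -> : (n - 2 < n - 2)%N = false by lia.
  by have -> : ((n - 2).+1 == n - 1)%N by [lia]; rewrite mulnC.
have rf3 k : row_factor n (n - 1 + k).+1 = ((n - 2) * (n - 1))%N.
  rewrite /row_factor; have -> : ((n - 1 + k).+1 == 1)%N = false by lia.
  have -> : (n - 1 + k < n - 2)%N = false by lia.
  by have -> : ((n - 1 + k).+1 == n - 1)%N = false by [lia]; rewrite mulnC.
split=> [[]|E].
  move=> /(block_eq0 _ _ _ d1) E1 /(block_eq0 _ _ _ d2) E2.
  move=> /(block_eq0 _ _ _ d3) E3 /(block_eq0 _ _ _ d4) E4 k km.
  have [->|k0] := eqVneq k 0%N; first by rewrite rf0 (E1 0%N).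
  have [k1|k1] := ltnP k (n - 2).
    rewrite -(subnKC (_ : 1 <= k)%N); last by lia.
    by rewrite rf1 ?E2 //; lia.
  have [->|k2] := eqVneq k (n - 2)%N.
    by rewrite rf2 -mulnA -[X in coord _ X]addn0 E3.
  rewrite -(subnKC (_ : n - 1 <= k)%N); last by lia.
  by rewrite rf3 E4 //; lia.
rewrite /blocks; congr (_, _, _, _); apply/block_eq0 => // k ks.
- by have := E k; rewrite add0n (_ : k = 0)%N ?rf0; [apply|]; lia.
- by have := E (1 + k)%N; rewrite rf1 //; apply; lia.
- have := E (n - 2)%N; rewrite rf2 -mulnA (_ : k = 0)%N ?addn0; last by lia.
  by apply; lia.
by have := E (n - 1 + k)%N; rewrite rf3; apply; lia.
Qed.

Lemma blocks_onto g : exists w, blocks w = g.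
Proof.
case: g => -[[g1 g2] g3] g4.
pose W k : int := if (k < 1)%N then lift_block g1 k
  else if (k < n - 2)%N then lift_block g2 (k - 1)
  else if (k < n - 1)%N then lift_block g3 (k - (n - 2))
  else lift_block g4 (k - (n - 1)).
have mE := nvecE.
exists (\row_i W i); congr (_, _, _, _); apply: block_lift => i ik;
  (rewrite coord_row; last by lia); rewrite /W.
- by rewrite add0n ik.
- have -> : (1 + i < 1)%N = false by lia.
  by have -> : (1 + i < n - 2)%N by [lia]; rewrite addKn.
- have -> : (n - 2 + i < 1)%N = false by lia.
  have -> : (n - 2 + i < n - 2)%N = false by lia.
  by have -> : (n - 2 + i < n - 1)%N by [lia]; rewrite addKn.
have -> : (n - 1 + i < 1)%N = false by lia.
have -> : (n - 1 + i < n - 2)%N = false by lia.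
by have -> : (n - 1 + i < n - 1)%N = false by [lia]; rewrite addKn.
Qed.

HB.instance Definition _ := GRing.isZmodMorphism.Build
  'rV[int]_(nvec n) invariant_sum blocks blocks_zmod.

Lemma dual_quotient_iso : isomorphic (dual_quotient n (lam22 n)) invariant_sum.
Proof.
pose phi : {additive Zdual (specht n (lam22 n)) -> 'rV[int]_(nvec n)} :=
  dual_row x yvec_Zbasis.
pose psi : {additive 'rV[int]_(nvec n) -> invariant_sum} := blocks.
(* The kernel of the composite is the image of S^lambda: both are given by divisibility of the
   coordinates by the diagonal entries. *)
apply: (@isomorphic_quot _ _ _ (psi \o phi : {additive _ -> _})) => [f|g].
  rewrite (dual_row_image xvec_Zbasis yvec_Zbasis gram_lower gram_diag_neq0 gram_dvd).
  by apply/forallP/eqP => /blocks_eq0.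
have [w <-] := blocks_onto g.
by have [f <-] := dual_row_onto yvec_Zbasis gram_lower gram_diag_neq0 w; exists f.
Qed.

End GramMatrix.

Theorem theorem5p14 (n : nat) (n_ge6 : (6 <= n)%N) :
  isomorphic (dual_quotient n (lam22 n))
    (Zmod_pow (2 ^ odd n * (2 * (n - 4)`!)) 1
     * Zmod_pow ((n - 1) * (2 * (n - 4)`!)) (n - 3)
     * Zmod_pow (2 ^ (~~ odd n) * ((n - 1) * (2 * (n - 4)`!))) 1
     * Zmod_pow ((n - 2) * (n - 1) * (2 * (n - 4)`!))
         ((n ^ 2 + 2 - 5 * n) %/ 2))%type
  /\ (let x := fun i : 'I_(nvec n) => xvec n i.+1 in
      let y := fun i : 'I_(nvec n) => yvec n i.+1 in
      [/\ Zbasis_specht x, Zbasis_specht y & trigonalize x y]).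
Proof.
split; first exact: dual_quotient_iso n_ge6.
by split; [exact: xvec_Zbasis|exact: yvec_Zbasis|exact: trigonalize_xy].
Qed.
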